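(* Let $\Omega\subset\mathbb R^3$ be an open set that contains the origin. Then there do not exist maps $u_1,u_2\in H^1(\Omega,S^2)$ such that $$u_1+u_2=\frac{x}{|x|}\qquad\text{a.e. in }\Omega.$$
   Context: $S^2$ is the unit sphere of $\mathbb R^3$, and $H^1(\Omega,S^2)=\{u\in H^1(\Omega,\mathbb R^3):|u|=1\text{ a.e. in }\Omega\}$. *)

(* Defs.v *)
From HB Require Import structures.
From mathcomp Require Import all_boot all_order all_algebra.
From mathcomp Require Import all_classical all_reals all_analysis.

Set Implicit Arguments.
Unset Strict Implicit.
Unset Printing Implicit Defensive.

Import Order.TTheory GRing.Theory Num.Theory.
Import numFieldNormedType.Exports.

Local Open Scope classical_set_scope.
Local Open Scope ring_scope.

Section H1_R3.
Context {R : realType}.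
Local Notation R3 := (R * R * R)%type.

(* The same type, with each factor carrying the Borel sigma-algebra on which
   lebesgue_measure is declared. *)
Local Notation mR3 :=
  (measurableTypeR R * measurableTypeR R * measurableTypeR R)%type.

Definition coord3 (i : 'I_3) (x : R3) : R := tnth [tuple x.1.1; x.1.2; x.2] i.

Definition basis3 (i : 'I_3) : R3 :=
  ((i == 0%N :> nat)%:R, (i == 1%N :> nat)%:R, (i == 2%N :> nat)%:R).

(* The library norm `|x| on a product type is the sup norm, hence this
   separate definition of the Euclidean norm. *)
Definition enorm (x : R3) : R := Num.sqrt (\sum_(i < 3) coord3 i x ^+ 2).

Definition lebesgue3 : {measure set mR3 -> \bar R} :=
  ((@lebesgue_measure R \x @lebesgue_measure R) \x @lebesgue_measure R)%E.

Definition partial3 (i : 'I_3) (f : R3 -> R) : R3 -> R := 'D_(basis3 i) f.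

(* C^oo: all iterated partial derivatives exist and are continuous.  The
   derivative operator is total, so existence is required separately. *)
Definition smooth (f : R3 -> R) : Prop :=
  forall s : seq 'I_3,
    continuous (foldr partial3 f s) /\
    forall (i : 'I_3) (x : R3), derivable (foldr partial3 f s) x (basis3 i).

Definition tsupport (f : R3 -> R) : set R3 := closure [set x | f x != 0].

Definition test_function (Omega : set R3) (phi : R3 -> R) : Prop :=
  [/\ smooth phi, compact (tsupport phi) & tsupport phi `<=` Omega].

(* Elements of L^2 are represented by Borel functions, which exist in every
   a.e.-class of Lebesgue measurable functions. *)
Definition L2 (Omega : set R3) (f : R3 -> R) : Prop :=
  measurable_fun (Omega : set mR3) f /\
  (\int[lebesgue3]_(x in Omega) ((f x ^+ 2)%:E) < +oo)%E.

Definition weak_partial (Omega : set R3) (i : 'I_3) (f g : R3 -> R) : Prop :=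
  forall phi : R3 -> R, test_function Omega phi ->
    (\int[lebesgue3]_(x in Omega) ((f x * partial3 i phi x)%R%:E) =
     - \int[lebesgue3]_(x in Omega) ((g x * phi x)%R%:E))%E.

Definition sobolev_H1 (Omega : set R3) (f : R3 -> R) : Prop :=
  L2 Omega f /\
  forall i : 'I_3, exists2 g : R3 -> R, L2 Omega g & weak_partial Omega i f g.

Definition sobolev_H1_vec (Omega : set R3) (u : R3 -> R3) : Prop :=
  forall i : 'I_3, sobolev_H1 Omega (coord3 i \o u).

Definition sobolev_H1_S2 (Omega : set R3) (u : R3 -> R3) : Prop :=
  sobolev_H1_vec Omega u /\ {ae lebesgue3, forall x, Omega x -> enorm (u x) = 1}.

End H1_R3.

(* Main.v *)
Require Import Defs.
From HB Require Import structures.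
From mathcomp Require Import all_boot all_order all_algebra.
From mathcomp Require Import all_classical all_reals all_analysis.
From mathcomp Require Import measurable_realfun ring lra.

Import Order.TTheory GRing.Theory Num.Theory.
Import numFieldNormedType.Exports.

Local Open Scope classical_set_scope.
Local Open Scope ring_scope.

(** Put w = u1 - u2.  Since u1 and u2 are unit vectors whose sum is the unit
    vector x / |x|, the parallelogram law gives |w|^2 = 3, and w is orthogonal
    to x (sphere_algebra).  Thus w is an H^1 field of constant length that is
    tangent to all spheres centred at the origin, and the statement is a hairy
    ball theorem for such fields.  Neither degree theory nor restriction to
    spheres is needed: the obstruction is a single integral identity on a
    small ball.

    Let g_b be the weak derivative of w in the direction b.  Differentiating
    |w|^2 = 3 and x . w = 0 gives w . g_b = 0 (deriv_norm) and
    x . g_b = - w_b (deriv_orth) almost everywhere.  The null form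
    (d_b w_j) (d_c w_l) - (d_c w_j) (d_b w_l) is a divergence, so its integral
    against a test function phi equals the integral of
    w_l ((d_c w_j) (d_b phi) - (d_b w_j) (d_c phi)) (weak_deriv_curl).  This is
    used with phi = x_a x_k eta, where eta is a radial bump, and summed with the
    sign of (a, b, c) times that of (j, k, l).  On the left appear the
    determinants of x, g_b and g_c, which vanish since these three vectors are
    orthogonal to w.  On the right the derivatives of eta cancel, and the
    constraints reduce what remains to a multiple of |w|^2 eta, that is of eta
    (alternating_sum).  Hence eta has integral 0, which is absurd.

    The analytic point is to justify products of weak derivatives that are only
    square-integrable.  Instead of smoothing one factor, every identity is first
    written as an exact relation between double integrals of
    rho_n(x - y) F(x) G(y), where rho_n is a mollifier: for fixed y, or fixed x,
    the mollifier is a legitimate test function, and Fubini does the rest.  These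
    double integrals converge to the integral of F G for square-integrable F and
    G when G is supported in a fixed cube (kern_pairing_cvg).  To prove it one
    bounds the error by the oscillation, the double integral of
    rho_n(x - y) (G x - G y)^2, which tends to 0 for indicators of sets with
    negligible boundary by dominated convergence, then for all Borel subsets of
    the cube by a Dynkin system argument, and finally for square-integrable
    functions supported there by density of simple functions. *)

(** * A smooth function flat at the origin *)

Section FlatFunctions.
Context {R : realType}.
Implicit Types (s t : R) (n : nat).

(** The functions t^-n exp (-1/t) for t > 0, extended by 0.  The derivative of
    one of them is a linear combination of two others, so the family is closed
    under differentiation and consists of smooth functions. *)
Definition flat n t : R := if 0 < t then t^-1 ^+ n * expR (- t^-1) else 0.

Lemma pow_le_expR n s : 0 <= s -> s ^+ n <= n%:R ^+ n * expR s.
Proof.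
move=> s0; case: n => [|n]; first by rewrite !expr0 mul1r -expR0 ler_expR.
have n0 : (0 : R) < n.+1%:R by [].
(* From 1 + u <= expR u with u = s / n.+1, raised to the power n.+1. *)
have -> : expR s = expR (s / n.+1%:R) ^+ n.+1.
  by rewrite -expRM_natl; congr expR; rewrite mulrC divfK ?gt_eqF.
rewrite -exprMn; apply: lerXn2r.
- by rewrite nnegrE.
- by rewrite nnegrE mulr_ge0// ?expR_ge0 ?ler0n.
rewrite -ler_pdivrMl// mulrC; apply: le_trans (expR_ge1Dx _).
by rewrite lerDr.
Qed.

Lemma flat_ge0 n t : 0 <= flat n t.
Proof.
by rewrite /flat; case: ifPn => // t0; rewrite mulr_ge0 ?expR_ge0// exprn_ge0// invr_ge0 ltW.
Qed.

Lemma flat_le n t : flat n t <= n%:R ^+ n.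
Proof.
rewrite /flat; case: ifPn => [t0|_]; last by rewrite exprn_ge0.
by rewrite expRN ler_pdivrMr ?expR_gt0// pow_le_expR// invr_ge0 ltW.
Qed.

Lemma flat_eq0 n t : t <= 0 -> flat n t = 0.
Proof. by rewrite /flat leNgt => /negbTE ->. Qed.

Lemma flat_gt0 n t : 0 < t -> 0 < flat n t.
Proof. by move=> t0; rewrite /flat t0 mulr_gt0 ?expR_gt0// exprn_gt0// invr_gt0. Qed.

Lemma flat0_homo : {homo flat 0 : s t / s <= t}.
Proof.
move=> s t st; have [s0|s0] := leP s 0; first by rewrite flat_eq0 ?flat_ge0.
have t0 := lt_le_trans s0 st.
by rewrite /flat s0 t0 !expr0 !mul1r ler_expR lerN2 lef_pV2.
Qed.

Lemma flat_le_sqr n t : flat n t <= n.+2%:R ^+ n.+2 * t ^+ 2.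
Proof.
have [t0|t0] := leP t 0; first by rewrite flat_eq0// mulr_ge0 ?sqr_ge0// exprn_ge0.
have -> : flat n t = flat n.+2 t * t ^+ 2.
  have e : t^-1 ^+ 2 * t ^+ 2 = 1 by rewrite -exprMn mulVf ?gt_eqF// expr1n.
  by rewrite /flat t0 -[LHS]mulr1 -e (exprD _ 2 n); ring.
by rewrite ler_wpM2r ?sqr_ge0// flat_le.
Qed.

(** At the origin the difference quotient is controlled by the quadratic bound
    flat_le_sqr. *)
Lemma is_derive_flat n t :
  is_derive t 1 (flat n) (flat n.+2 t - n%:R * flat n.+1 t).
Proof.
have [t0|t0|->] := ltgtP t 0.
- rewrite !flat_eq0 ?ltW// mulr0 subr0.
  apply: (@near_eq_is_derive _ _ _ (cst 0)).
  near=> s; rewrite flat_eq0//; apply/ltW; near: s; exact: lt_nbhsl.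
- have tn0 : t != 0 by rewrite gt_eqF.
  rewrite /flat t0.
  apply: (@near_eq_is_derive _ _ _
    ((fun s => s^-1) ^+ n * (expR \o (fun s => - s^-1)))).
    near=> s.
    have -> : 0 < s by near: s; exact: lt_nbhsr.
    by rewrite !fctE.
  have iV : is_derive t 1 (fun s => s^-1) (- t ^- 2).
    split; first exact: derivableV.
    by rewrite deriveV// derive_id scaler1.
  have iVn : is_derive t 1 (fun s => - s^-1) (t ^- 2).
    by have := is_deriveN iV; rewrite opprK.
  apply: is_derive_eq => /=.
  rewrite !fctE /= /GRing.scale/=.
  case: n => [|n] /=; first by field.
  rewrite !exprS; by field.
- rewrite !flat_eq0// mulr0 subr0.
  suff H : (fun h : R => h^-1 *: ((flat n \o shift 0) (h *: 1) - flat n 0)) @ 0^'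
      --> (0 : R).
    by split; [apply/cvg_ex; exists 0|apply/cvg_lim].
  apply/cvgr0Pnorm_le => e e0; near=> h.
  have h0 : h != 0 by near: h; exact: nbhs_dnbhs_neq.
  rewrite /= [_ *: 1]mulr1 addr0 (flat_eq0 n 0 (lexx 0)) subr0 normrM normfV.
  rewrite (ger0_norm (flat_ge0 _ _)) ler_pdivrMl ?normr_gt0//.
  apply: (le_trans (flat_le_sqr n h)); rewrite -real_normK ?num_real// expr2.
  rewrite mulrC -mulrA ler_wpM2l// -ler_pdivlMr ?exprn_gt0//.
  near: h; apply: dnbhs0_le; rewrite divr_gt0// exprn_gt0//.
Unshelve. all: by end_near. Qed.

End FlatFunctions.

(** * A class of smooth functions *)

Notation R3 R := (R * R * R)%type.
(** The same type as R3, seen as a product of Borel spaces. *)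
Notation mR3 R :=
  (measurableTypeR R * measurableTypeR R * measurableTypeR R)%type.

(** The three coordinate indices. *)
Definition i0 : 'I_3 := @Ordinal 3 0 isT.
Definition i1 : 'I_3 := @Ordinal 3 1 isT.
Definition i2 : 'I_3 := @Ordinal 3 2 isT.

Lemma ord3_ind (P : 'I_3 -> Prop) : P i0 -> P i1 -> P i2 -> forall i, P i.
Proof.
move=> P0 P1 P2 [[|[|[|//]]] Hi].
- by rewrite (_ : Ordinal Hi = i0) //; exact/val_inj.
- by rewrite (_ : Ordinal Hi = i1) //; exact/val_inj.
- by rewrite (_ : Ordinal Hi = i2) //; exact/val_inj.
Qed.

Section TestFunctions.
Context {R : realType}.
Implicit Types (f g : R3 R -> R) (x a : R3 R) (i j : 'I_3).

Lemma coord30 x : coord3 i0 x = x.1.1. Proof. by []. Qed.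
Lemma coord31 x : coord3 i1 x = x.1.2. Proof. by []. Qed.
Lemma coord32 x : coord3 i2 x = x.2. Proof. by []. Qed.

(** Functions built from constants and coordinates by sums, products and
    composition with flat.  The class is closed under partial derivatives, which
    makes its members smooth; all test functions used below belong to it. *)
Inductive tfun : (R3 R -> R) -> Prop :=
| tfun_cst c : tfun (fun=> c)
| tfun_coord i : tfun (coord3 i)
| tfun_add f g : tfun f -> tfun g -> tfun (fun x => f x + g x)
| tfun_mul f g : tfun f -> tfun g -> tfun (fun x => f x * g x)
| tfun_flat n f : tfun f -> tfun (fun x => flat n (f x)).

Lemma fst_diff (U V : normedModType R) (y : U * V) :
  is_diff y (@fst U V) (@fst U V).
Proof.
have c : continuous (@fst U V) by move=> z; exact: cvg_fst.
by split; [exact: linear_differentiable|exact: diff_lin].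
Qed.

Lemma snd_diff (U V : normedModType R) (y : U * V) :
  is_diff y (@snd U V) (@snd U V).
Proof.
have c : continuous (@snd U V) by move=> z; exact: cvg_snd.
by split; [exact: linear_differentiable|exact: diff_lin].
Qed.

Lemma coord3_is_diff i x : is_diff x (coord3 i) (coord3 i).
Proof.
elim/ord3_ind: i; last exact: snd_diff.
- exact: (@is_diff_comp _ _ _ _ fst fst fst fst x (fst_diff _ _ x) (fst_diff _ _ x.1)).
- exact: (@is_diff_comp _ _ _ _ fst fst snd snd x (fst_diff _ _ x) (snd_diff _ _ x.1)).
Qed.

Lemma coord3_derive i v x : 'D_v (coord3 i) x = coord3 i v.
Proof. by have [d e] := coord3_is_diff i x; rewrite deriveE// e. Qed.

Lemma flat_diff n (t : R) : differentiable (flat n) t.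
Proof. by apply/derivable1_diffP; have [] := is_derive_flat n t. Qed.

Lemma tfun_diff f : tfun f -> forall x, differentiable f x.
Proof.
elim => [c|i|{}f g _ df _ dg|{}f g _ df _ dg|n {}f _ df] x.
- exact: differentiable_cst.
- by have [] := coord3_is_diff i x.
- exact: differentiableD.
- exact: differentiableM.
- apply: (@differentiable_comp _ _ _ _ f (flat n)) => //; exact: flat_diff.
Qed.

Lemma partial3_cst i (c : R) : partial3 i (fun=> c) = fun=> 0.
Proof. by apply/funext => x; rewrite /partial3 derive_cst. Qed.

Lemma partial3_coord i j : partial3 i (@coord3 R j) = fun=> (i == j)%:R.
Proof.
apply/funext => x; rewrite /partial3 coord3_derive.
by move: i j; do 2 elim/ord3_ind.
Qed.

Lemma partial3_add i f g : tfun f -> tfun g ->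
  partial3 i (fun x => f x + g x) = fun x => partial3 i f x + partial3 i g x.
Proof.
move=> tf tg; apply/funext => x; apply: deriveD; apply: diff_derivable;
  exact: tfun_diff.
Qed.

Lemma partial3_mul i f g : tfun f -> tfun g ->
  partial3 i (fun x => f x * g x) =
  fun x => partial3 i f x * g x + f x * partial3 i g x.
Proof.
move=> tf tg; apply/funext => x; rewrite /partial3 deriveM.
- by rewrite addrC /GRing.scale/= mulrC.
- by apply: diff_derivable; exact: tfun_diff.
- by apply: diff_derivable; exact: tfun_diff.
Qed.

Lemma partial3_flat i n f : tfun f ->
  partial3 i (fun x => flat n (f x)) =
  fun x => (flat n.+2 (f x) - n%:R * flat n.+1 (f x)) * partial3 i f x.
Proof.
move=> tf; apply/funext => x; rewrite /partial3 deriveE; last first.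
  apply: (@differentiable_comp _ _ _ _ f (flat n)); last exact: flat_diff.
  exact: tfun_diff.
rewrite (@diff_comp _ _ _ _ f (flat n)); last first.
- exact: flat_diff.
- exact: tfun_diff.
have dn := is_derive_flat n (f x).
rewrite deriv1E; last by case: dn.
rewrite derive1E derive_val /= [X in _ = _ * X]deriveE; first exact: mulrC.
exact: tfun_diff.
Qed.

Lemma tfun_partial i f : tfun f -> tfun (partial3 i f).
Proof.
elim => [c|j|{}f g tf df tg dg|{}f g tf df tg dg|n {}f tf df].
- by rewrite partial3_cst; exact: tfun_cst.
- by rewrite partial3_coord; exact: tfun_cst.
- by rewrite partial3_add//; exact: tfun_add.
- by rewrite partial3_mul//; apply: tfun_add; exact: tfun_mul.
- rewrite partial3_flat//; apply: tfun_mul => //; apply: tfun_add.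
    exact: tfun_flat.
  rewrite (_ : (fun x => - _) = fun x => - n%:R * flat n.+1 (f x)).
    by apply: tfun_mul; [exact: tfun_cst|exact: tfun_flat].
  by apply/funext => x; rewrite mulNr.
Qed.

Lemma tfun_smooth f : tfun f -> smooth f.
Proof.
move=> tf s; have {}tf : tfun (foldr partial3 f s).
  by elim: s => //= i s; exact: tfun_partial.
split=> [x|i x]; first exact/differentiable_continuous/tfun_diff.
exact/diff_derivable/tfun_diff.
Qed.

Lemma measurable_coord3 i : measurable_fun [set: mR3 R] (@coord3 R i).
Proof.
elim/ord3_ind: i; rewrite /coord3/=.
- exact: (measurableT_comp measurable_fst measurable_fst).
- exact: (measurableT_comp measurable_snd measurable_fst).
- exact: measurable_snd.
Qed.

Lemma measurable_flat n : measurable_fun [set: R] (flat n).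
Proof.
apply: continuous_measurable_fun => t.
exact/differentiable_continuous/flat_diff.
Qed.

Lemma tfun_measurable f : tfun f -> measurable_fun [set: mR3 R] f.
Proof.
elim => [c|i|{}f g _ mf _ mg|{}f g _ mf _ mg|n {}f _ mf].
- exact: measurable_cst.
- exact: measurable_coord3.
- exact: measurable_funD.
- exact: measurable_funM.
- exact: (measurableT_comp (measurable_flat n)).
Qed.

(** The squared Euclidean distance. *)
Definition sqd a x : R :=
  (x.1.1 - a.1.1) ^+ 2 + (x.1.2 - a.1.2) ^+ 2 + (x.2 - a.2) ^+ 2.

Lemma tfun_bounded f : tfun f ->
  forall s, exists M, forall x, sqd 0 x <= s -> `|f x| <= M.
Proof.
elim => [c|i|{}f g _ Mf _ Mg|{}f g _ Mf _ Mg|n {}f _ _] s.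
- by exists `|c|.
- exists (1 + s) => x xs.
  have : coord3 i x ^+ 2 <= s.
    apply: le_trans xs; rewrite /sqd /= !subr0.
    elim/ord3_ind: i; rewrite /coord3/=.
    + by rewrite -addrA lerDl addr_ge0 ?sqr_ge0.
    + by rewrite addrAC lerDr addr_ge0 ?sqr_ge0.
    + by rewrite lerDr addr_ge0 ?sqr_ge0.
  move: (coord3 i x) => t ts; rewrite ler_norml; apply/andP; split; nra.
- have [M1 H1] := Mf s; have [M2 H2] := Mg s; exists (M1 + M2) => x xs.
  by rewrite (le_trans (ler_normD _ _))// lerD ?H1 ?H2.
- have [M1 H1] := Mf s; have [M2 H2] := Mg s; exists (M1 * M2) => x xs.
  by rewrite normrM ler_pM ?H1 ?H2.
- by exists (n%:R ^+ n) => x _; rewrite ger0_norm ?flat_ge0 ?flat_le.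
Qed.

Lemma sqdE a x : sqd a x = \sum_(i < 3) (coord3 i x - coord3 i a) ^+ 2.
Proof. by rewrite !big_ord_recr big_ord0 /= add0r. Qed.

Lemma tfun_sub f g : tfun f -> tfun g -> tfun (fun x => f x - g x).
Proof.
move=> tf tg; apply: tfun_add => //.
rewrite (_ : (fun x => - g x) = fun x => -1 * g x).
  by apply: tfun_mul => //; exact: tfun_cst.
by apply/funext => x; rewrite mulN1r.
Qed.

Lemma tfun_sqd a : tfun (sqd a).
Proof.
have h i : tfun (fun x => (coord3 i x - coord3 i a) ^+ 2).
  by apply: tfun_mul; apply: tfun_sub; (exact: tfun_coord || exact: tfun_cst).
exact: (tfun_add _ _ (tfun_add _ _ (h i0) (h i1)) (h i2)).
Qed.

Lemma partial3_sqd i a :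
  partial3 i (sqd a) = fun x => 2 * (coord3 i x - coord3 i a).
Proof.
have t j : tfun (fun x => coord3 j x - coord3 j a).
  by apply: tfun_sub; (exact: tfun_coord || exact: tfun_cst).
have d j : partial3 i (fun x => coord3 j x - coord3 j a) = fun=> (i == j)%:R.
  rewrite partial3_add ?partial3_coord ?partial3_cst//.
  - by under eq_fun do rewrite addr0.
  - exact: tfun_coord.
  - exact: tfun_cst.
have h j : partial3 i (fun x => (coord3 j x - coord3 j a) ^+ 2) =
    fun x => 2 * (i == j)%:R * (coord3 j x - coord3 j a).
  rewrite (partial3_mul i _ _ (t j) (t j)) d; apply/funext => x; ring.
have t2 j : tfun (fun x => (coord3 j x - coord3 j a) ^+ 2) by exact: tfun_mul.
rewrite (_ : sqd a = fun x => (coord3 i0 x - coord3 i0 a) ^+ 2 +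
  (coord3 i1 x - coord3 i1 a) ^+ 2 + (coord3 i2 x - coord3 i2 a) ^+ 2)//.
rewrite partial3_add//; last exact: tfun_add.
rewrite partial3_add// !h; apply/funext => x.
by elim/ord3_ind: i {d h} => /=; rewrite !(mulr0, mul0r, mulr1, addr0, add0r).
Qed.

End TestFunctions.

(** * Lebesgue measure on R^3 as a sigma-finite measure *)

Section SigmaFiniteProduct.
Context {d1 d2} {T1 : measurableType d1} {T2 : measurableType d2} {R : realType}.
Variables (m1 : {sigma_finite_measure set T1 -> \bar R}).
Variables (m2 : {sigma_finite_measure set T2 -> \bar R}).

Lemma sigma_finite_product : sigma_finite setT (m1 \x m2)%E.
Proof.
have /sigma_finiteP[F [TF ndF Foo]] := sigma_finiteT m1.
have /sigma_finiteP[G [TG ndG Goo]] := sigma_finiteT m2.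
exists (fun n => F n `*` G n).
  rewrite -setXTT TF TG predeqE => -[x y]; split => [|[n _ []/= ? ?]]; last first.
    by split; exists n.
  move=> [/= [n _ Fnx] [k _ Gky]]; exists (maxn n k) => //; split.
  - by move: x Fnx; exact/subsetPset/ndF/leq_maxl.
  - by move: y Gky; exact/subsetPset/ndG/leq_maxr.
move=> k; have [mF Ff] := Foo k; have [mG Gf] := Goo k.
split; first exact: measurableX.
by rewrite product_measure1E// lte_mul_pinfty// ge0_fin_numE.
Qed.

End SigmaFiniteProduct.

(** The product measures are given names so that the sigma-finiteness proved
    above is attached to them; leb3 is convertible to lebesgue3. *)
Definition leb2 {R : realType} :
  set (measurableTypeR R * measurableTypeR R)%type -> \bar R :=
  (@lebesgue_measure R \x @lebesgue_measure R)%E.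
HB.instance Definition _ (R : realType) := Measure.on (@leb2 R).
HB.instance Definition _ (R : realType) := Measure_isSigmaFinite.Build _ _ _
  (@leb2 R) (sigma_finite_product _ _).

Definition leb3 {R : realType} : set (mR3 R) -> \bar R :=
  (@leb2 R \x @lebesgue_measure R)%E.
HB.instance Definition _ (R : realType) := Measure.on (@leb3 R).
HB.instance Definition _ (R : realType) := Measure_isSigmaFinite.Build _ _ _
  (@leb3 R) (sigma_finite_product _ _).

(** * Square-integrable functions *)

Section NonnegIntegrals.
Context {d} {T : measurableType d} {R : realType}.
Variable mu : {measure set T -> \bar R}.
Implicit Types f g : T -> R.

Lemma ge0_int_le f g : measurable_fun setT f -> measurable_fun setT g ->
  (forall x, 0 <= f x) -> (forall x, f x <= g x) ->
  (\int[mu]_x (f x)%:E <= \int[mu]_x (g x)%:E)%E.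
Proof.
move=> mf mg f0 fg; apply: ge0_le_integral => //.
- by move=> x _; rewrite lee_fin.
- exact/measurable_EFinP.
- exact/measurable_EFinP.
- by move=> x _; rewrite lee_fin.
Qed.

Lemma ge0_int_add f g : measurable_fun setT f -> measurable_fun setT g ->
  (forall x, 0 <= f x) -> (forall x, 0 <= g x) ->
  (\int[mu]_x (f x + g x)%:E = \int[mu]_x (f x)%:E + \int[mu]_x (g x)%:E)%E.
Proof.
move=> mf mg f0 g0; under eq_integral do rewrite EFinD.
rewrite ge0_integralD//; try by move=> x _; rewrite lee_fin.
- exact/measurable_EFinP.
- exact/measurable_EFinP.
Qed.

Lemma ge0_int_scale (k : R) f : measurable_fun setT f ->
  (forall x, 0 <= f x) -> 0 <= k ->
  (\int[mu]_x (k * f x)%:E = k%:E * \int[mu]_x (f x)%:E)%E.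
Proof.
move=> mf f0 k0; under eq_integral do rewrite EFinM.
rewrite ge0_integralZl_EFin//; first by move=> x _; rewrite lee_fin.
exact/measurable_EFinP.
Qed.

(** The square of the L^2 norm. *)
Definition L2n f : \bar R := (\int[mu]_x (f x ^+ 2)%:E)%E.

Lemma L2n_ge0 f : (0 <= L2n f)%E.
Proof. by apply: integral_ge0 => x _; rewrite lee_fin sqr_ge0. Qed.

Lemma measurable_sqr f : measurable_fun setT f ->
  measurable_fun setT (fun x => f x ^+ 2).
Proof. exact: measurable_funX. Qed.

Lemma L2n_scale k f : measurable_fun setT f ->
  L2n (fun x => k * f x) = ((k ^+ 2)%:E * L2n f)%E.
Proof.
move=> mf; rewrite /L2n -ge0_int_scale ?sqr_ge0//.
- by apply: eq_integral => x _; rewrite exprMn.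
- exact: measurable_sqr.
- by move=> x; rewrite sqr_ge0.
Qed.

Lemma L2n_add f g : measurable_fun setT f -> measurable_fun setT g ->
  (L2n (fun x => (f x + g x)%R) <= 2%:E * L2n f + 2%:E * L2n g)%E.
Proof.
move=> mf mg; rewrite /L2n -!ge0_int_scale//; try exact: measurable_sqr;
  try by move=> x; rewrite sqr_ge0.
have h1 (h : T -> R) : measurable_fun setT h ->
    measurable_fun setT (fun x => 2 * h x ^+ 2).
  by move=> mh; apply: measurable_funM => //; exact: measurable_sqr.
rewrite -ge0_int_add; try exact: h1;
  try by move=> x; rewrite mulr_ge0// sqr_ge0.
apply: ge0_int_le.
- by apply: measurable_sqr; exact: measurable_funD.
- by apply: measurable_funD; exact: h1.
- by move=> x; rewrite sqr_ge0.
- by move=> x; have := sqr_ge0 (f x - g x : R); nra.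
Qed.

Lemma L2_mul_integrable f g : measurable_fun setT f -> measurable_fun setT g ->
  (L2n f < +oo)%E -> (L2n g < +oo)%E ->
  mu.-integrable setT (EFin \o (fun x => f x * g x)).
Proof.
move=> mf mg ff gf; apply/integrableP; split.
  by apply/measurable_EFinP; exact: measurable_funM.
apply: (@le_lt_trans _ _ (L2n f + L2n g)%E); last by rewrite lte_add_pinfty.
rewrite /L2n -ge0_int_add; try exact: measurable_sqr;
  try by move=> x; rewrite sqr_ge0.
apply: (@ge0_int_le (fun x => `|f x * g x|)) => //.
- by apply: measurableT_comp => //; exact: measurable_funM.
- by apply: measurable_funD; exact: measurable_sqr.
- move=> x; rewrite ler_norml; apply/andP.
  have := sqr_ge0 (f x - g x : R); have := sqr_ge0 (f x + g x : R).
  by split; nra.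
Qed.

End NonnegIntegrals.

(** * Approximate identities *)

Section ApproximateIdentity.
Import HBNNSimple.
Context {d} {T : measurableType d} {R : realType}.
Variable mu : {sigma_finite_measure set T -> \bar R}.
Variable K : nat -> T * T -> R.
Hypothesis mK : forall n, measurable_fun setT (K n).
Hypothesis K_ge0 : forall n z, 0 <= K n z.
Hypothesis intK1 : forall n x, (\int[mu]_y (K n (x, y))%:E = 1)%E.
Hypothesis intK2 : forall n y, (\int[mu]_x (K n (x, y))%:E = 1)%E.
Implicit Types F G : T -> R.
Local Notation mumu := (mu \x mu)%E.

Lemma measurable_fun1 F : measurable_fun setT F ->
  measurable_fun setT (fun z : T * T => F z.1).
Proof. by move=> mF; exact: (measurableT_comp mF measurable_fst). Qed.

Lemma measurable_fun2 F : measurable_fun setT F ->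
  measurable_fun setT (fun z : T * T => F z.2).
Proof. by move=> mF; exact: (measurableT_comp mF measurable_snd). Qed.

Lemma int_kernel1 n F : measurable_fun setT F -> (forall x, 0 <= F x) ->
  (\int[mumu]_z (K n z * F z.1)%:E = \int[mu]_x (F x)%:E)%E.
Proof.
move=> mF F0; rewrite fubini_tonelli1; last 2 first.
- by apply/measurable_EFinP; apply: measurable_funM => //; exact: measurable_fun1.
- by move=> z; rewrite lee_fin mulr_ge0.
apply: eq_integral => x _; rewrite /fubini_F/=.
under eq_integral do rewrite mulrC.
rewrite ge0_int_scale ?intK1 ?mule1//.
exact: (measurableT_comp (mK n) (pair1_measurable x)).
Qed.

Lemma int_kernel2 n F : measurable_fun setT F -> (forall x, 0 <= F x) ->
  (\int[mumu]_z (K n z * F z.2)%:E = \int[mu]_x (F x)%:E)%E.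
Proof.
move=> mF F0; rewrite fubini_tonelli2; last 2 first.
- by apply/measurable_EFinP; apply: measurable_funM => //; exact: measurable_fun2.
- by move=> z; rewrite lee_fin mulr_ge0.
apply: eq_integral => y _; rewrite /fubini_G/=.
under eq_integral do rewrite mulrC.
rewrite ge0_int_scale ?intK2 ?mule1//.
exact: (measurableT_comp (mK n) (pair2_measurable y)).
Qed.

(** The mean square oscillation of G at the scale of the kernel K n:
    the double integral of K_n(x,y) (G x - G y)^2.  The kernel has total mass 1 in
    each variable, so up to a factor 4 it is bounded by the squared L^2 norm,
    uniformly in n. *)
Definition osc n G : \bar R :=
  (\int[mumu]_z (K n z * (G z.1 - G z.2) ^+ 2)%:E)%E.

Lemma measurable_osc n G : measurable_fun setT G ->
  measurable_fun setT (fun z => K n z * (G z.1 - G z.2) ^+ 2).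
Proof.
move=> mG; apply: measurable_funM => //; apply: measurable_funX.
by apply: measurable_funB; [exact: measurable_fun1|exact: measurable_fun2].
Qed.

Lemma osc_fun_ge0 n G z : 0 <= K n z * (G z.1 - G z.2) ^+ 2.
Proof. by rewrite mulr_ge0// sqr_ge0. Qed.

Lemma osc_le_L2n n G : measurable_fun setT G -> (osc n G <= 4%:E * L2n mu G)%E.
Proof.
move=> mG; have mG2 := measurable_sqr _ mG.
have G20 x : 0 <= G x ^+ 2 by rewrite sqr_ge0.
have m1 : measurable_fun setT (fun z : T * T => 2 * (K n z * G z.1 ^+ 2)).
  by do 2 apply: measurable_funM => //; exact: (measurable_fun1 (fun x => G x ^+ 2)).
have m2 : measurable_fun setT (fun z : T * T => 2 * (K n z * G z.2 ^+ 2)).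
  by do 2 apply: measurable_funM => //; exact: (measurable_fun2 (fun x => G x ^+ 2)).
have p1 (z : T * T) : 0 <= 2 * (K n z * G z.1 ^+ 2) by apply: mulr_ge0 => //; apply: mulr_ge0.
have p2 (z : T * T) : 0 <= 2 * (K n z * G z.2 ^+ 2) by apply: mulr_ge0 => //; apply: mulr_ge0.
have -> : (4%:E * L2n mu G = \int[mumu]_z (2 * (K n z * G z.1 ^+ 2) +
    2 * (K n z * G z.2 ^+ 2))%:E)%E.
  rewrite ge0_int_add// !ge0_int_scale//.
  - rewrite (int_kernel1 n _ mG2)// (int_kernel2 n _ mG2)// -ge0_muleDl//.
    by rewrite -EFinD; congr (_%:E * _)%E; ring.
  - by apply: measurable_funM => //; exact: (measurable_fun2 (fun x => G x ^+ 2)).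
  - by move=> z; rewrite mulr_ge0.
  - by apply: measurable_funM => //; exact: (measurable_fun1 (fun x => G x ^+ 2)).
  - by move=> z; rewrite mulr_ge0.
apply: ge0_int_le => //.
- exact: measurable_osc.
- exact: measurable_funD.
- by move=> z; exact: osc_fun_ge0.
- move=> z; rewrite (_ : _ + _ = K n z * (2 * G z.1 ^+ 2 + 2 * G z.2 ^+ 2)).
    rewrite ler_wpM2l//.
    by have := sqr_ge0 (G z.1 + G z.2); nra.
  ring.
Qed.

Lemma osc_add n F G : measurable_fun setT F -> measurable_fun setT G ->
  (osc n (fun x => (F x + G x)%R) <= 2%:E * osc n F + 2%:E * osc n G)%E.
Proof.
move=> mF mG.
have m (H : T -> R) : measurable_fun setT H -> measurable_fun setT
    (fun z : T * T => 2 * (K n z * (H z.1 - H z.2) ^+ 2)).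
  by move=> mH; apply: measurable_funM => //; exact: measurable_osc.
rewrite -!ge0_int_scale//; try exact: measurable_osc;
  try exact: osc_fun_ge0.
rewrite -ge0_int_add; try exact: m;
  try by move=> z; rewrite mulr_ge0// osc_fun_ge0.
apply: ge0_int_le.
- by have := measurable_osc n _ (measurable_funD mF mG).
- by apply: measurable_funD; exact: m.
- by move=> z; rewrite mulr_ge0// sqr_ge0.
- move=> z; rewrite (_ : 2 * _ + _ = K n z *
      (2 * (F z.1 - F z.2) ^+ 2 + 2 * (G z.1 - G z.2) ^+ 2)).
    rewrite ler_wpM2l//.
    by have := sqr_ge0 ((F z.1 - F z.2) - (G z.1 - G z.2)); nra.
  ring.
Qed.

Lemma osc_scale n k G : measurable_fun setT G ->
  (osc n (fun x => (k * G x)%R) = (k ^+ 2)%:E * osc n G)%E.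
Proof.
move=> mG; rewrite -ge0_int_scale ?sqr_ge0//.
- by apply: eq_integral => z _; congr EFin; ring.
- exact: measurable_osc.
- by move=> z; exact: osc_fun_ge0.
Qed.

(** Vanishing oscillation.  The functions with this property form a subspace
    closed under L^2 limits. *)
Definition vanosc G := forall e : R, 0 < e ->
  \forall n \near \oo, (osc n G <= e%:E)%E.

Lemma vanosc_add F G : measurable_fun setT F -> measurable_fun setT G ->
  vanosc F -> vanosc G -> vanosc (fun x => F x + G x).
Proof.
move=> mF mG vF vG e e0.
have e4 : 0 < e / 4 by rewrite divr_gt0.
near=> n; apply: (le_trans (osc_add n _ _ mF mG)).
have -> : e%:E = (2%:E * (e / 4)%:E + 2%:E * (e / 4)%:E)%E.
  by rewrite -!EFinM -EFinD; congr EFin; field.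
by apply: leeD; apply: lee_wpmul2l => //; near: n; [exact: vF|exact: vG].
Unshelve. all: by end_near. Qed.

Lemma vanosc_scale k G : measurable_fun setT G ->
  vanosc G -> vanosc (fun x => k * G x).
Proof.
move=> mG vG e e0.
have k1 : 0 < k ^+ 2 + 1 by rewrite ltr_wpDl// sqr_ge0.
have ek : 0 < e / (k ^+ 2 + 1) by rewrite divr_gt0.
near=> n; rewrite osc_scale//.
apply: (@le_trans _ _ ((k ^+ 2)%:E * (e / (k ^+ 2 + 1))%:E)%E).
  by apply: lee_wpmul2l; rewrite ?lee_fin ?sqr_ge0//; near: n; exact: vG.
rewrite -EFinM lee_fin mulrA ler_pdivrMr// mulrC ler_pM2l//.
by rewrite lerDl.
Unshelve. all: by end_near. Qed.

Lemma vanosc_closed G : measurable_fun setT G ->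
  (forall e : R, 0 < e -> exists F, [/\ measurable_fun setT F, vanosc F &
    (L2n mu (fun x => (G x - F x)%R) <= e%:E)%E]) -> vanosc G.
Proof.
move=> mG H e e0; have e16 : 0 < e / 16 by rewrite divr_gt0.
have [F [mF vF GF]] := H _ e16.
have e4 : 0 < e / 4 by rewrite divr_gt0.
have mGF : measurable_fun setT (fun x => G x - F x) by exact: measurable_funB.
near=> n.
have -> : G = fun x => F x + (G x - F x).
  by apply/funext => x; rewrite addrC subrK.
apply: (le_trans (osc_add n _ _ mF mGF)).
have -> : e%:E = (2%:E * (e / 4)%:E + 2%:E * (4%:E * (e / 16)%:E))%E.
  by rewrite -!EFinM -EFinD; congr EFin; field.
apply: leeD; apply: lee_wpmul2l => //; first by near: n; exact: vF.
by apply: (le_trans (osc_le_L2n n _ mGF)); apply: lee_wpmul2l.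
Unshelve. all: by end_near. Qed.

Lemma vanosc_sum (I : Type) (r : seq I) (F : I -> T -> R) :
  (forall i, measurable_fun setT (F i)) -> (forall i, vanosc (F i)) ->
  vanosc (fun x => \sum_(i <- r) F i x).
Proof.
move=> mF vF; elim: r => [|i r IH].
  under eq_fun do rewrite big_nil.
  move=> e e0; near=> n; rewrite (_ : osc n _ = 0%E) ?lee_fin ?ltW//.
  by apply: integral0_eq => z _; rewrite subrr expr0n mulr0.
under eq_fun do rewrite big_cons.
by apply: vanosc_add => //; exact: measurable_sum.
Unshelve. all: by end_near. Qed.

(** Simple functions are dense in L^2, by dominated convergence; it is thus
    enough to know the property for indicators. *)
Lemma vanosc_nonneg (D : set T) G : measurable D ->
  (forall A, measurable A -> vanosc \1_(A `&` D)) ->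
  measurable_fun setT G -> (forall x, 0 <= G x) ->
  (forall x, ~ D x -> G x = 0) -> (L2n mu G < +oo)%E -> vanosc G.
Proof.
move=> mD vD mG G0 GD LG; apply: vanosc_closed => // e e0.
have mGE : measurable_fun setT (EFin \o G) by exact/measurable_EFinP.
pose f n := nnsfun_approx measurableT mGE n.
have fle n x : f n x <= G x.
  rewrite -lee_fin /f nnsfun_approxE; apply: (@le_approx _ _ _ setT) => //.
  by move=> y _; rewrite lee_fin.
have fcvg x : f ^~ x @ \oo --> G x.
  have G0' y : setT y -> (0 <= (EFin \o G) y)%E by rewrite lee_fin.
  by have /fine_cvg := cvg_nnsfun_approx measurableT mGE G0' (x := x) I.
have mf n : measurable_fun setT (f n) by [].
have vf n : vanosc (f n).
  have -> : (f n : T -> R) = fun x => \sum_(y <- finmap.enum_fset (fset_set (range (f n))))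
      y * \1_(f n @^-1` [set y] `&` D) x.
    apply/funext => x.
    have [Dx|Dx] := pselect (D x).
      rewrite fimfunE fsbig_finite//=; apply: eq_bigr => y _.
      by rewrite indicI/= [\1_D x]indicE mem_set// mulr1.
    have -> : f n x = 0 by apply/eqP; rewrite eq_le -{1}(GD _ Dx) fle /=.
    rewrite big1// => y _.
    by rewrite indicI/= [\1_D x]indicE memNset// !mulr0.
  have mfn y : measurable (f n @^-1` [set y]).
    by rewrite -[X in measurable X]setTI; exact: mf.
  have mfD y : measurable (f n @^-1` [set y] `&` D) by exact: measurableI.
  apply: vanosc_sum => y.
    by apply: measurable_funM => //; exact: measurable_indic.
  by apply: vanosc_scale; [exact: measurable_indic|exact: vD].
have : (fun n => L2n mu (fun x => (G x - f n x)%R)) @ \oo --> 0%E.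
  have := @dominated_convergence _ _ _ mu setT measurableT
    (fun n x => ((G x - f n x) ^+ 2)%:E) (cst 0%E) (fun x => (G x ^+ 2)%:E).
  case=> [n| | | | |_ _].
  - by apply/measurable_EFinP; apply: measurable_funX; exact: measurable_funB.
  - exact: measurable_cst.
  - apply: aeW => x _; apply: cvg_EFin; first exact: nearW.
    rewrite /comp/= -[X in _ --> X](_ : (G x - G x) * (G x - G x) = 0).
      by apply: cvgM; apply: cvgB => //; exact: cvg_cst.
    by rewrite subrr mulr0.
  - apply/integrableP; split.
      by apply/measurable_EFinP; exact: measurable_funX.
    by under eq_integral do rewrite gee0_abs ?lee_fin ?sqr_ge0//.
  - apply: aeW => x n _; rewrite gee0_abs ?lee_fin ?sqr_ge0//.
    rewrite lerXn2r ?nnegrE ?subr_ge0//.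
    by rewrite lerBlDr lerDl.
  by rewrite integral0.
move=> cv; have [N _ HN] := cv _ (open_ereal_lt' (e0 : (0 < e%:E)%E)).
by exists (f N); split=> //; apply/ltW/HN => /=.
Qed.

Lemma vanosc_L2 (D : set T) G : measurable D ->
  (forall A, measurable A -> vanosc \1_(A `&` D)) ->
  measurable_fun setT G ->
  (forall x, ~ D x -> G x = 0) -> (L2n mu G < +oo)%E -> vanosc G.
Proof.
move=> mD vD mG GD LG.
have mp (H : T -> R) : measurable_fun setT H ->
    measurable_fun setT (fun x => Num.max (H x) 0).
  by move=> mH; apply: measurable_maxr.
have L (H : T -> R) : measurable_fun setT H ->
    (forall x, H x ^+ 2 <= G x ^+ 2) -> (L2n mu H < +oo)%E.
  move=> mH HG; apply: le_lt_trans LG; apply: ge0_int_le => //.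
  - exact: measurable_funX.
  - exact: measurable_funX.
  - by move=> x; rewrite sqr_ge0.
have mN : measurable_fun setT (fun x => - G x) by exact: measurable_funN.
have -> : G = fun x => Num.max (G x) 0 + (-1) * Num.max (- G x) 0.
  apply/funext => x; rewrite mulN1r.
  case: (leP (G x) 0) => h; case: (leP (- G x) 0) => h'; lra.
have b (t : R) : Num.max t 0 ^+ 2 <= t ^+ 2.
  by case: (leP t 0) => h; rewrite ?expr0n ?sqr_ge0.
apply: vanosc_add; [exact: mp|by apply: measurable_funM => //; exact: mp| | ].
  apply: (@vanosc_nonneg D) => //; first exact: mp.
  - by move=> x; rewrite le_max lexx orbT.
  - by move=> x /GD ->; rewrite maxxx.
  - by apply: L; [exact: mp|move=> x; exact: b].
apply: vanosc_scale; first exact: mp.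
apply: (@vanosc_nonneg D) => //; first exact: mp.
- by move=> x; rewrite le_max lexx orbT.
- by move=> x /GD ->; rewrite oppr0 maxxx.
- by apply: L; [exact: mp|move=> x; rewrite -[leRHS]sqrrN; exact: b].
Qed.

(** The double integral of K_n(x,y) F(x) G(y), that is the integral of F
    against the mollification of G. *)
Definition pairing n F G : R :=
  fine (\int[mumu]_z (K n z * (F z.1 * G z.2))%:E)%E.

Lemma pairing_integrable n F G : measurable_fun setT F -> measurable_fun setT G ->
  (L2n mu F < +oo)%E -> (L2n mu G < +oo)%E ->
  mumu.-integrable setT (EFin \o (fun z => K n z * (F z.1 * G z.2))).
Proof.
move=> mF mG LF LG; apply/integrableP; split.
  apply/measurable_EFinP; apply: measurable_funM => //; apply: measurable_funM.
    exact: measurable_fun1.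
  exact: measurable_fun2.
have mF2 := measurable_sqr _ mF; have mG2 := measurable_sqr _ mG.
have F20 x : 0 <= F x ^+ 2 by rewrite sqr_ge0.
have G20 x : 0 <= G x ^+ 2 by rewrite sqr_ge0.
apply: (@le_lt_trans _ _ (L2n mu F + L2n mu G)%E); last by rewrite lte_add_pinfty.
have m1 : measurable_fun setT (fun z : T * T => K n z * F z.1 ^+ 2).
  by apply: measurable_funM => //; exact: (measurable_fun1 (fun x => F x ^+ 2)).
have m2 : measurable_fun setT (fun z : T * T => K n z * G z.2 ^+ 2).
  by apply: measurable_funM => //; exact: (measurable_fun2 (fun x => G x ^+ 2)).
rewrite /L2n -(int_kernel1 n _ mF2)// -(int_kernel2 n _ mG2)// -ge0_int_add//;
  try by move=> z; rewrite mulr_ge0.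
apply: (@ge0_int_le _ _ _ mumu (fun z => `|K n z * (F z.1 * G z.2)|)) => //.
- apply: measurableT_comp => //; apply: measurable_funM => //.
  by apply: measurable_funM; [exact: measurable_fun1|exact: measurable_fun2].
- exact: measurable_funD.
- move=> z; rewrite normrM (ger0_norm (K_ge0 n z)) -mulrDr ler_wpM2l//.
  rewrite ler_norml; apply/andP.
  have := sqr_ge0 (F z.1 - G z.2); have := sqr_ge0 (F z.1 + G z.2).
  by split; nra.
Qed.

Lemma diagonal_integrable n F G : measurable_fun setT F -> measurable_fun setT G ->
  (L2n mu F < +oo)%E -> (L2n mu G < +oo)%E ->
  mumu.-integrable setT (EFin \o (fun z => K n z * (F z.1 * G z.1))).
Proof.
move=> mF mG LF LG.
have mFG : measurable_fun setT (fun x => F x * G x) by exact: measurable_funM.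
have /integrableP[_ fin] := L2_mul_integrable mu _ _ mF mG LF LG.
apply/integrableP; split.
  apply/measurable_EFinP; apply: measurable_funM => //.
  exact: (measurable_fun1 (fun x => F x * G x)).
rewrite (_ : (\int[mumu]_x _)%E =
    (\int[mumu]_z (K n z * `|F z.1 * G z.1|)%:E)%E); last first.
  by apply: eq_integral => z _ /=; rewrite normrM (ger0_norm (K_ge0 n z)).
have mN : measurable_fun setT (fun x => `|F x * G x|) by exact: measurableT_comp.
by rewrite (int_kernel1 n (fun x => `|F x * G x|)).
Qed.

Lemma diagonal_integral n F G : measurable_fun setT F -> measurable_fun setT G ->
  (L2n mu F < +oo)%E -> (L2n mu G < +oo)%E ->
  (\int[mumu]_z (K n z * (F z.1 * G z.1))%:E = \int[mu]_x (F x * G x)%:E)%E.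
Proof.
move=> mF mG LF LG.
rewrite -(integral12_prod_meas1 (diagonal_integrable n F G mF mG LF LG)).
apply: eq_integral => x _; rewrite /fubini_F/=.
under eq_integral do rewrite mulrC EFinM.
rewrite integralZl ?intK1 ?mule1//.
have mKx : measurable_fun setT (fun y => K n (x, y)).
  exact: (measurableT_comp (mK n) (pair1_measurable x)).
apply/integrableP; split; first exact/measurable_EFinP.
under eq_integral do rewrite gee0_abs ?lee_fin//.
by rewrite intK1 ltry.
Qed.

(** The difference with the integral of F G is the double integral of
    K_n(x,y) F(x) (G(x) - G(y)), which is at most s |F|^2 + osc_n(G) / s for every
    s > 0. *)
Lemma pairing_cvg F G : measurable_fun setT F -> measurable_fun setT G ->
  (L2n mu F < +oo)%E -> (L2n mu G < +oo)%E -> vanosc G ->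
  pairing n F G @[n --> \oo] --> \int[mu]_x (F x * G x).
Proof.
move=> mF mG LF LG vG; apply/cvgrPdist_le => e e0.
pose L := fine (L2n mu F).
have LE : L2n mu F = L%:E by rewrite fineK// ge0_fin_numE// L2n_ge0.
have L0 : 0 <= L by rewrite fine_ge0// L2n_ge0.
have L1 : 0 < L + 1 by rewrite ltr_wpDl.
(* Both s |F|^2 and osc_n(G) / s are made at most e / 2. *)
pose s := e / 2 / (L + 1).
have s0 : 0 < s by rewrite !divr_gt0.
have es : 0 < e / 2 * s by rewrite mulr_gt0// divr_gt0.
near=> n.
have i1 := diagonal_integrable n F G mF mG LF LG.
have i2 := pairing_integrable n F G mF mG LF LG.
have h : (\int[mumu]_z (K n z * (F z.1 * (G z.1 - G z.2)))%:E =
   (\int[mu]_x (F x * G x) - pairing n F G)%:E)%E.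
  rewrite EFinB /pairing /Rintegral !fineK; last 2 first.
  - exact: (integrable_fin_num measurableT i2).
  - exact: (integrable_fin_num measurableT (L2_mul_integrable mu _ _ mF mG LF LG)).
  rewrite -(diagonal_integral n F G mF mG LF LG).
  rewrite -(integralB measurableT i1 i2).
  by apply: eq_integral => z _ /=; rewrite -EFinB; congr EFin; ring.
have mF2 := measurable_sqr _ mF.
have F20 x : 0 <= F x ^+ 2 by rewrite sqr_ge0.
have mKF : measurable_fun setT (fun z : T * T => K n z * F z.1 ^+ 2).
  by apply: measurable_funM => //; exact: (measurable_fun1 (fun x => F x ^+ 2)).
have mO := measurable_osc n _ mG.
have mI : measurable_fun setT (fun z => K n z * (F z.1 * (G z.1 - G z.2))).
  apply: measurable_funM => //; apply: measurable_funM; first exact: measurable_fun1.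
  by apply: measurable_funB; [exact: measurable_fun1|exact: measurable_fun2].
rewrite -lee_fin -abse_EFin -h.
apply: le_trans (le_abse_integral _ measurableT _) _; first exact/measurable_EFinP.
have vGn : (osc n G <= (e / 2 * s)%:E)%E by near: n; exact: vG.
apply: (@le_trans _ _ (\int[mumu]_z (s * (K n z * F z.1 ^+ 2) +
    s^-1 * (K n z * (G z.1 - G z.2) ^+ 2))%:E)%E).
  apply: (@ge0_int_le _ _ _ mumu (fun z => `|K n z * (F z.1 * (G z.1 - G z.2))|)).
  - exact: measurableT_comp.
  - by apply: measurable_funD; exact: measurable_funM.
  - by move=> z; exact: normr_ge0.
  - move=> z; rewrite normrM (ger0_norm (K_ge0 n z)).
    rewrite (mulrCA s) (mulrCA s^-1) -mulrDr ler_wpM2l//.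
    move: (F z.1) (G z.1 - G z.2) => a b.
    have -> : s * a ^+ 2 + s^-1 * b ^+ 2 = s^-1 * ((s * a) ^+ 2 + b ^+ 2).
      by field; rewrite gt_eqF.
    rewrite ler_pdivlMl// -[X in X * _](gtr0_norm s0) -normrM mulrA.
    have := sqr_ge0 (s * a - b); have := sqr_ge0 (s * a + b).
    by rewrite ler_norml => ? ?; apply/andP; split; nra.
have si : 0 <= s^-1 by rewrite invr_ge0 ltW.
rewrite ge0_int_add//; last 4 first.
- exact: measurable_funM.
- exact: measurable_funM.
- by move=> z; apply: mulr_ge0; [exact: ltW|exact: mulr_ge0].
- by move=> z; apply: mulr_ge0 => //; exact: osc_fun_ge0.
rewrite !ge0_int_scale//; last 3 first.
- by move=> z; exact: osc_fun_ge0.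
- by move=> z; rewrite mulr_ge0.
- exact: ltW.
rewrite (int_kernel1 n _ mF2)// -/(L2n mu F) LE -/(osc n G).
have -> : e%:E = ((e / 2)%:E + (s^-1)%:E * (e / 2 * s)%:E)%E.
  by rewrite -EFinM -EFinD; congr EFin; field; rewrite gt_eqF.
apply: leeD; last exact: lee_wpmul2l.
rewrite -EFinM lee_fin /s mulrAC ler_pdivrMr// ler_pM2l ?divr_gt0//.
by rewrite lerDl.
Unshelve. all: by end_near. Qed.

End ApproximateIdentity.

(** * Reflection invariance of Lebesgue measure *)

Section Reflection.
Context {R : realType}.
Local Notation leb1 := (@lebesgue_measure R).
Implicit Type a : R.

Definition refl1 a : measurableTypeR R -> measurableTypeR R := fun x => a - x.

Lemma measurable_refl1 a : measurable_fun setT (refl1 a).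
Proof. exact: measurable_funB. Qed.

HB.instance Definition _ a :=
  isMeasurableFun.Build _ _ _ _ (refl1 a) (measurable_refl1 a).

Lemma lebesgue_measure_refl a (A : set R) : measurable A ->
  pushforward leb1 (refl1 a) A = leb1 A.
Proof.
move=> mA; apply/esym/lebesgue_measure_unique => //= _ [[b c]] _ <-.
rewrite /pushforward.
have -> : refl1 a @^-1` `]b, c]%classic = `[a - c, a - b[%classic.
  apply/seteqP; split => x /=; rewrite !in_itv/= /refl1 => /andP[h1 h2];
    apply/andP; split; lra.
rewrite !lebesgue_measure_itv/= !lte_fin.
by rewrite ltrD2l ltrN2 -!EFinB; case: ifP => // _; congr EFin; ring.
Qed.

Lemma ge0_integral_refl1 a (f : R -> \bar R) : measurable_fun setT f ->
  (forall x, 0 <= f x)%E ->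
  (\int[leb1]_x f (a - x)%R = \int[leb1]_x f x)%E.
Proof.
move=> mf f0.
have := @ge0_integral_pushforward _ _ _ _ _ _ (measurable_refl1 a) leb1 setT f
  measurableT mf (fun y _ => f0 y).
rewrite preimage_setT /comp => <-.
by apply: eq_measure_integral => A mA _; exact: lebesgue_measure_refl.
Qed.

Lemma ge0_integral_refl2 (a1 a2 : R) (f : R * R -> \bar R) :
  measurable_fun [set: measurableTypeR R * measurableTypeR R] f ->
  (forall x, 0 <= f x)%E ->
  (\int[leb2]_x f (a1 - x.1, a2 - x.2)%R = \int[leb2]_x f x)%E.
Proof.
move=> mf f0.
have mg : measurable_fun [set: measurableTypeR R * measurableTypeR R]
    (fun x => f (a1 - x.1, a2 - x.2)%R).
  apply: (measurableT_comp mf); apply: measurable_fun_pair.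
    exact: (measurableT_comp (measurable_refl1 a1) measurable_fst).
  exact: (measurableT_comp (measurable_refl1 a2) measurable_snd).
rewrite /leb2 (fubini_tonelli1 _ mg)// (fubini_tonelli1 _ mf)//.
have mF : measurable_fun setT (fubini_F leb1 f).
  exact: measurable_fun_fubini_tonelli_F.
rewrite -[RHS](ge0_integral_refl1 a1)//; last first.
  by move=> x; apply: integral_ge0.
apply: eq_integral => x _; rewrite /fubini_F/=.
apply: (ge0_integral_refl1 a2 (fun y => f (a1 - x, y)%R)) => //.
exact: (measurableT_comp mf (pair1_measurable (a1 - x : measurableTypeR R))).
Qed.

(** The point reflection x -> a - x.  Invariance under these maps contains both
    the translation invariance and the parity argument needed for the mollifier. *)
Definition refl3 (a x : R3 R) : R3 R := (a.1.1 - x.1.1, a.1.2 - x.1.2, a.2 - x.2).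

Lemma measurable_refl3 (a : R3 R) : measurable_fun [set: mR3 R] (refl3 a : mR3 R -> mR3 R).
Proof.
apply: measurable_fun_pair; first apply: measurable_fun_pair.
- exact: (measurableT_comp (measurable_refl1 a.1.1) (measurableT_comp measurable_fst measurable_fst)).
- exact: (measurableT_comp (measurable_refl1 a.1.2) (measurableT_comp measurable_snd measurable_fst)).
- exact: (measurableT_comp (measurable_refl1 a.2) measurable_snd).
Qed.

Lemma ge0_integral_refl3 (a : R3 R) (f : R3 R -> \bar R) :
  measurable_fun [set: mR3 R] f -> (forall x, 0 <= f x)%E ->
  (\int[leb3]_x f (refl3 a x) = \int[leb3]_x f x)%E.
Proof.
move=> mf f0.
have mg := measurableT_comp mf (measurable_refl3 a).
rewrite /leb3 (fubini_tonelli1 _ mg)//; last by move=> ?; exact: f0.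
rewrite (fubini_tonelli1 _ mf)//.
have mF : measurable_fun setT (fubini_F leb1 f).
  exact: measurable_fun_fubini_tonelli_F.
rewrite -[RHS](ge0_integral_refl2 a.1.1 a.1.2)//; last first.
  by move=> x; apply: integral_ge0.
apply: eq_integral => x _; rewrite /fubini_F/=.
apply: (ge0_integral_refl1 a.2 (fun y => f (a.1.1 - x.1, a.1.2 - x.2, y)%R)) => //.
exact: (measurableT_comp mf (pair1_measurable
  ((a.1.1 - x.1, a.1.2 - x.2)%R : measurableTypeR R * measurableTypeR R))).
Qed.

End Reflection.

(** * Sets with negligible boundary *)

Section Cubes.
Context {R : realType}.
Local Notation leb1 := (@lebesgue_measure R).
Implicit Types (x y : R3 R) (A N : set (mR3 R)).

Definition cube (r : R) : set (mR3 R) :=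
  (`]- r, r[%classic `*` `]- r, r[%classic) `*` `]- r, r[%classic.

Lemma cubeP r x : cube r x <-> forall i, - r < coord3 i x < r.
Proof.
rewrite /cube /= !in_itv/=; split => [[[h1 h2] h3]|h].
  by elim/ord3_ind.
by split; [split|]; [exact: (h i0)|exact: (h i1)|exact: (h i2)].
Qed.

Lemma measurable_cube r : measurable (cube r).
Proof. by do 2 apply: measurableX => //. Qed.

Lemma leb3X (A1 A2 A3 : set (measurableTypeR R)) :
  measurable A1 -> measurable A2 -> measurable A3 ->
  leb3 ((A1 `*` A2) `*` A3) = (leb1 A1 * leb1 A2 * leb1 A3)%E.
Proof.
move=> m1 m2 m3; have m12 := measurableX m1 m2.
transitivity (leb2 (A1 `*` A2) * leb1 A3)%E.
  exact: (product_measure1E leb2 leb1 m12 m3).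
congr (_ * _)%E; exact: (product_measure1E leb1 leb1 m1 m2).
Qed.

Lemma leb3_cube r : 0 < r -> leb3 (cube r) = ((r + r) ^+ 3)%:E.
Proof.
move=> r0; rewrite leb3X// !lebesgue_measure_itv/= lte_fin gtrN//.
by rewrite -EFinB opprK -!EFinM; congr EFin; ring.
Qed.

Lemma leb3_coord_null i (a : R) : leb3 [set x : mR3 R | coord3 i x = a] = 0.
Proof.
have h1 : leb1 [set a] = 0%E by rewrite lebesgue_measure_set1.
elim/ord3_ind: i.
- rewrite (_ : mkset _ = ([set a] `*` setT) `*` setT).
    by rewrite leb3X// h1 !mul0e.
  by apply/seteqP; split => x /=; [|case=> -[]].
- rewrite (_ : mkset _ = (setT `*` [set a]) `*` setT).
    by rewrite leb3X// h1 mule0 mul0e.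
  by apply/seteqP; split => x /=; [|case=> -[]].
- rewrite (_ : mkset _ = (setT `*` setT) `*` [set a]).
    by rewrite leb3X// h1 mule0.
  by apply/seteqP; split => x /=; [|case=> -[]].
Qed.

Lemma sqdC x y : sqd x y = sqd y x.
Proof. by rewrite /sqd; ring. Qed.

Lemma coord3_sqd i x y : (coord3 i x - coord3 i y) ^+ 2 <= sqd x y.
Proof.
rewrite sqdC sqdE (bigD1 i)//= lerDl sumr_ge0// => j _; exact: sqr_ge0.
Qed.

(** Measurable sets whose indicator is locally constant outside a null set.
    They are stable under intersection and generate the Borel sets. *)
Definition null_boundary A := measurable A /\ exists N, [/\ measurable N,
  leb3 N = 0%E & forall x, ~ N x -> exists2 e : R, 0 < e &
    forall y, sqd x y < e -> A x <-> A y].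

Lemma null_boundaryI A B : null_boundary A -> null_boundary B ->
  null_boundary (A `&` B).
Proof.
move=> [mA [N [mN N0 NA]]] [mB [M [mM M0 MB]]]; split; first exact: measurableI.
exists (N `|` M); split; [exact: measurableU|exact: null_set_setU|].
move=> x /not_orP[/NA[e e0 he] /MB[f f0 hf]]; exists (Num.min e f).
  by rewrite lt_min e0.
by move=> y; rewrite lt_min => /andP[/he h1 /hf h2]; rewrite /setI/=; tauto.
Qed.

Lemma null_boundary_lt i (a : R) : null_boundary [set x | coord3 i x < a].
Proof.
have mc := @measurable_coord3 R i.
split.
  rewrite (_ : mkset _ = setT `&` coord3 i @^-1` `]-oo, a[%classic).
    exact: mc.
  by rewrite setTI; apply/seteqP; split => x /=; rewrite in_itv/=.
exists [set x | coord3 i x = a]; split; last 2 first.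
- exact: leb3_coord_null.
- move=> x /= /eqP xa; exists ((coord3 i x - a) ^+ 2).
    by rewrite exprn_even_gt0//= subr_eq0.
  move=> y hy; have := le_lt_trans (coord3_sqd i x y) hy.
  by move: (coord3 i x) (coord3 i y) xa => s t /eqP sa h;
    split=> ?; have [] := ltgtP s a; have [] := ltgtP t a; nra.
rewrite (_ : mkset _ = setT `&` coord3 i @^-1` [set a]); first exact: mc.
by rewrite setTI.
Qed.

Lemma null_boundary_gt i (a : R) : null_boundary [set x | a < coord3 i x].
Proof.
have mc := @measurable_coord3 R i.
split.
  rewrite (_ : mkset _ = setT `&` coord3 i @^-1` `]a, +oo[%classic).
    exact: mc.
  by rewrite setTI; apply/seteqP; split => x /=; rewrite in_itv/= andbT.
exists [set x | coord3 i x = a]; split; last 2 first.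
- exact: leb3_coord_null.
- move=> x /= /eqP xa; exists ((coord3 i x - a) ^+ 2).
    by rewrite exprn_even_gt0//= subr_eq0.
  move=> y hy; have := le_lt_trans (coord3_sqd i x y) hy.
  by move: (coord3 i x) (coord3 i y) xa => s t /eqP sa h;
    split=> ?; have [] := ltgtP s a; have [] := ltgtP t a; nra.
rewrite (_ : mkset _ = setT `&` coord3 i @^-1` [set a]); first exact: mc.
by rewrite setTI.
Qed.

Lemma null_boundary_cube r : null_boundary (cube r).
Proof.
have -> : cube r = [set x | coord3 i0 x < r] `&` [set x | - r < coord3 i0 x] `&`
    ([set x | coord3 i1 x < r] `&` [set x | - r < coord3 i1 x]) `&`
    ([set x | coord3 i2 x < r] `&` [set x | - r < coord3 i2 x]).
  apply/seteqP; split => x.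
    by move/cubeP => h; split; [split|];
      split; rewrite /= ?(andP (h i0)) ?(andP (h i1)) ?(andP (h i2));
      have /andP[] := h i0; have /andP[] := h i1; have /andP[] := h i2.
  by move=> [[[h1 h2] [h3 h4]] [h5 h6]]; apply/cubeP; elim/ord3_ind; apply/andP.
by do !apply: null_boundaryI; (exact: null_boundary_lt || exact: null_boundary_gt).
Qed.

Lemma measurable_null_boundary :
  @measurable _ (mR3 R) = <<s null_boundary >>.
Proof.
apply/seteqP; split; last first.
  by apply: smallest_sub; [exact: sigma_algebra_measurable|move=> A []].
have idm : measurable_fun setT
    (id : g_sigma_algebraType null_boundary -> mR3 R).
  have c i : measurable_fun setT
      (coord3 i : g_sigma_algebraType null_boundary -> measurableTypeR R).
    apply: (measurability _ (RGenInftyO.measurableE R)).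
    move=> _ [_ [a ->] <-]; rewrite setTI.
    apply: sub_sigma_algebra.
    rewrite (_ : _ @^-1` _ = [set x | coord3 i x < a]).
      exact: null_boundary_lt.
    by apply/seteqP; split => x /=; rewrite in_itv/=.
  apply/measurable_fun_pairP; split; last exact: (c i2).
  by apply/measurable_fun_pairP; split; [exact: (c i0)|exact: (c i1)].
by move=> A mA; have := idm measurableT A mA; rewrite setTI.
Qed.

End Cubes.

(** * The mollifier *)

Section MollifierKernel.
Context {R : realType}.
Implicit Types (x y a : R3 R) (delta : R).

Lemma int_indic3 (A : set (mR3 R)) : measurable A ->
  (\int[leb3]_x (\1_A x : R)%:E = leb3 A)%E.
Proof. by move=> mA; rewrite integral_indic// setIT. Qed.

Lemma measurable_sqd a : measurable_fun [set: mR3 R] (sqd a).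
Proof. by apply: tfun_measurable; exact: tfun_sqd. Qed.

(** A radial bump around a, positive exactly where the squared distance to a
    is less than delta. *)
Definition bump delta a x : R := flat 0 (delta - sqd a x).

Lemma tfun_bump n delta a : tfun (fun x => flat n (delta - sqd a x)).
Proof.
apply: tfun_flat; apply: tfun_sub; first exact: tfun_cst.
exact: tfun_sqd.
Qed.

Lemma measurable_bump delta a : measurable_fun [set: mR3 R] (bump delta a).
Proof. by apply: tfun_measurable; exact: tfun_bump. Qed.

Lemma bump_ge0 delta a x : 0 <= bump delta a x.
Proof. exact: flat_ge0. Qed.

Lemma bump_le1 delta a x : bump delta a x <= 1.
Proof. exact: (flat_le 0). Qed.

(** The integral of a bump; it does not depend on the centre (int_bump). *)
Definition bump_mass delta : \bar R := (\int[leb3]_x (bump delta 0 x)%:E)%E.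

Lemma int_bump delta a : (\int[leb3]_x (bump delta a x)%:E = bump_mass delta)%E.
Proof.
rewrite -(ge0_integral_refl3 a (fun x => (bump delta a x)%:E)).
- apply: eq_integral => x _; congr (flat 0 (delta - _))%:E.
  by rewrite /sqd/=; ring.
- by apply/measurable_EFinP; exact: measurable_bump.
- by move=> x; rewrite lee_fin bump_ge0.
Qed.

Lemma bump_eq0 n delta a x : delta <= sqd a x -> flat n (delta - sqd a x) = 0.
Proof. by move=> h; rewrite flat_eq0// subr_le0. Qed.

Lemma sqd_cube delta x : 0 <= delta <= 1 -> sqd 0 x < delta -> cube 1 x.
Proof.
move=> /andP[d0 d1] h; apply/cubeP => i; have := coord3_sqd i x 0.
have -> : coord3 i (0 : R3 R) = 0 by elim/ord3_ind: i.
rewrite subr0 sqdC => h2; apply/andP; split; nra.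
Qed.

Lemma bump_mass_lty delta : 0 <= delta <= 1 -> (bump_mass delta < +oo)%E.
Proof.
move=> d01; apply: (@le_lt_trans _ _ (leb3 (cube 1))).
  rewrite -int_indic3; last exact: measurable_cube.
  apply: ge0_int_le.
  - exact: measurable_bump.
  - by apply: measurable_indic; exact: measurable_cube.
  - by move=> x; exact: bump_ge0.
  - move=> x; have [h|h] := ltP (sqd 0 x) delta; last by rewrite /bump bump_eq0.
    rewrite indicE mem_set ?bump_le1//; exact: sqd_cube h.
by rewrite leb3_cube// ltry.
Qed.

Lemma bump_mass_gt0 delta : 0 < delta <= 1 -> (0 < bump_mass delta)%E.
Proof.
move=> /andP[d0 d1].
have c0 : 0 < flat 0 (delta / 2) by rewrite flat_gt0// divr_gt0.
(* On the cube of half-side delta / 3 the squared norm is at most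
   delta ^+ 2 / 3 <= delta / 2. *)
have r0 : 0 < delta / 3 by rewrite divr_gt0.
apply: (@lt_le_trans _ _ ((flat 0 (delta / 2))%:E * leb3 (cube (delta / 3)))%E).
  rewrite leb3_cube// -EFinM lte_fin mulr_gt0// exprn_gt0// addr_gt0//.
have mc := @measurable_cube R (delta / 3).
rewrite -int_indic3// -ge0_int_scale ?flat_ge0//.
rewrite /bump_mass; apply: ge0_int_le.
- apply: measurable_funM => //; exact: measurable_indic.
- exact: measurable_bump.
- by move=> x; rewrite mulr_ge0 ?flat_ge0// indicE.
- move=> x; rewrite indicE; have [/set_mem/cubeP h|_] := boolP (x \in _).
    rewrite mulr1; apply: flat0_homo.
    suff : sqd 0 x <= delta / 2 by lra.
    rewrite /sqd /= !subr0.
    have b (t : R) : - (delta / 3) < t < delta / 3 -> t ^+ 2 <= delta / 3 / 3.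
      by move=> /andP[? ?]; nra.
    have b0 : x.1.1 ^+ 2 <= delta / 3 / 3 := b _ (h i0).
    have b1 : x.1.2 ^+ 2 <= delta / 3 / 3 := b _ (h i1).
    have b2 : x.2 ^+ 2 <= delta / 3 / 3 := b _ (h i2).
    lra.
  by rewrite mulr0 bump_ge0.
Qed.

(** The mollifier as a function of a pair of points: the normalized bump of the
    difference of the two points. *)
Definition kap delta (z : R3 R * R3 R) : R :=
  bump delta z.2 z.1 / fine (bump_mass delta).

Lemma measurable_sqd2 :
  measurable_fun [set: mR3 R * mR3 R] (fun z => sqd z.2 z.1).
Proof.
have m i : measurable_fun [set: mR3 R * mR3 R]
    (fun z => (coord3 i z.1 - coord3 i z.2) ^+ 2).
  apply: measurable_funX; apply: measurable_funB.
    exact: (measurableT_comp (@measurable_coord3 R i) measurable_fst).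
  exact: (measurableT_comp (@measurable_coord3 R i) measurable_snd).
exact: (measurable_funD (measurable_funD (m i0) (m i1)) (m i2)).
Qed.

Lemma measurable_bump2 n delta :
  measurable_fun [set: mR3 R * mR3 R] (fun z => flat n (delta - sqd z.2 z.1)).
Proof.
apply: (measurableT_comp (measurable_flat n)).
by apply: measurable_funB => //; exact: measurable_sqd2.
Qed.

Lemma measurable_kap delta : measurable_fun [set: mR3 R * mR3 R] (kap delta).
Proof. by apply: measurable_funM => //; exact: measurable_bump2. Qed.

Lemma kap_ge0 delta z : 0 <= kap delta z.
Proof. by rewrite divr_ge0 ?bump_ge0// fine_ge0// integral_ge0// => x _; rewrite lee_fin bump_ge0. Qed.

Lemma kapC delta x y : kap delta (x, y) = kap delta (y, x).
Proof. by rewrite /kap /bump sqdC. Qed.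

Lemma int_kap2 delta y : 0 < delta <= 1 ->
  (\int[leb3]_x (kap delta (x, y))%:E = 1)%E.
Proof.
move=> d01; have Z0 := bump_mass_gt0 _ d01.
have Zf : (bump_mass delta < +oo)%E.
  by apply: bump_mass_lty; case/andP: d01 => /ltW -> ->.
have ZE : bump_mass delta = (fine (bump_mass delta))%:E by rewrite fineK// ge0_fin_numE// ltW.
have fZ : 0 < fine (bump_mass delta) by rewrite -lte_fin -ZE.
under eq_integral do rewrite /kap mulrC.
rewrite ge0_int_scale ?invr_ge0 ?(ltW fZ)//=; last first.
- by move=> x; exact: bump_ge0.
- exact: measurable_bump.
by rewrite int_bump ZE/= -EFinM mulVf// gt_eqF.
Qed.

Lemma int_kap1 delta x : 0 < delta <= 1 ->
  (\int[leb3]_y (kap delta (x, y))%:E = 1)%E.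
Proof. by move=> d; under eq_integral do rewrite kapC; exact: int_kap2. Qed.

Lemma kap_eq0 delta x y : delta <= sqd y x -> kap delta (x, y) = 0.
Proof. by move=> h; rewrite /kap /bump bump_eq0// mul0r. Qed.

End MollifierKernel.

(** * Convergence of mollified pairings *)

Section MollifierSequence.
Context {R : realType}.
Variable delta : R.
Hypothesis delta01 : 0 < delta <= 1.
Implicit Types (A : set (mR3 R)) (F G : R3 R -> R).

(** A sequence of squared radii decreasing to 0, all bounded by delta. *)
Definition width n : R := delta / n.+1%:R.

Lemma width01 n : 0 < width n <= 1.
Proof.
have /andP[d0 d1] := delta01; rewrite divr_gt0//= ler_pdivrMr// mul1r.
by apply: (le_trans d1); rewrite ler1n.
Qed.

Lemma width_le n : width n <= delta.
Proof.
have /andP[d0 _] := delta01.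
by rewrite ler_pdivrMr// ler_peMr ?ler1n// ltW.
Qed.

Lemma width_lt (e : R) : 0 < e -> \forall n \near \oo, width n < e.
Proof.
move=> e0; near=> n; rewrite ltr_pdivrMr// -ltr_pdivrMl//.
apply: (@lt_trans _ _ n%:R); last by rewrite ltr_nat.
near: n; exact: nbhs_infty_gtr.
Unshelve. all: by end_near. Qed.

Definition kern n : R3 R * R3 R -> R := kap (width n).

Lemma mkern n : measurable_fun [set: mR3 R * mR3 R] (kern n).
Proof. exact: measurable_kap. Qed.

Lemma kern_ge0 n z : 0 <= kern n z. Proof. exact: kap_ge0. Qed.

Lemma int_kern1 n x : (\int[leb3]_y (kern n (x, y))%:E = 1)%E.
Proof. exact/int_kap1/width01. Qed.

Lemma int_kern2 n y : (\int[leb3]_x (kern n (x, y))%:E = 1)%E.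
Proof. exact/int_kap2/width01. Qed.

Local Notation vanosc := (@vanosc _ _ _ (@leb3 R) kern).
Local Notation osc := (@osc _ _ _ (@leb3 R) kern).

(** Off the boundary the inner integral vanishes as soon as the width of the
    kernel is small; dominated convergence concludes. *)
Lemma vanosc_null_boundary A : null_boundary A -> A `<=` cube 2 ->
  vanosc \1_A.
Proof.
move=> [mA [N [mN N0 NA]]] Acube.
pose f n x : \bar R := (\int[leb3]_y (kern n (x, y) * (\1_A x - \1_A y) ^+ 2)%:E)%E.
have mI : measurable_fun [set: mR3 R] (\1_A : mR3 R -> R) by exact: measurable_indic.
have mO n := measurable_osc kern mkern n _ mI.
have oscE n : osc n \1_A = (\int[leb3]_x f n x)%E.
  rewrite /osc fubini_tonelli1//; first by apply/measurable_EFinP; exact: mO.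
  by move=> z; rewrite lee_fin; apply: osc_fun_ge0; exact: kern_ge0.
have mf n : measurable_fun [set: mR3 R] (f n).
  suff : measurable_fun setT (fubini_F (@leb3 R) (fun z : mR3 R * mR3 R =>
      (kern n z * (\1_A z.1 - \1_A z.2) ^+ 2)%:E)) by [].
  apply: measurable_fun_fubini_tonelli_F.
    by apply/measurable_EFinP; exact: mO.
  by move=> z; rewrite lee_fin; apply: osc_fun_ge0; exact: kern_ge0.
have f0 n x : (0 <= f n x)%E.
  by apply: integral_ge0 => y _; rewrite lee_fin mulr_ge0 ?kern_ge0 ?sqr_ge0.
have fz n x (e : R) : (forall y, sqd x y < e -> A x <-> A y) ->
    width n <= e -> f n x = 0%E.
  move=> hx ne; apply: integral0_eq => y _.
  have [h|h] := leP (width n) (sqd y x); first by rewrite /kern kap_eq0// mul0r.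
  have Axy := hx y; rewrite sqdC in Axy; have {}Axy := Axy (lt_le_trans h ne).
  have -> : \1_A y = \1_A x :> R.
    rewrite !indicE; congr (nat_of_bool _)%:R.
    by apply/idP/idP => /set_mem ?; apply/mem_set; tauto.
  by rewrite subrr expr0n mulr0.
have f1 n x : (f n x <= (\1_(cube 3) x : R)%:E)%E.
  have [c3|c3] := pselect (cube 3 x).
    rewrite indicE mem_set//= -(int_kern1 n x); apply: ge0_int_le.
    - exact: (measurableT_comp (mO n) (pair1_measurable x)).
    - exact: (measurableT_comp (mkern n) (pair1_measurable x)).
    - by move=> y; rewrite mulr_ge0 ?kern_ge0 ?sqr_ge0.
    - move=> y; rewrite ler_piMr ?kern_ge0// !indicE.
  rewrite indicE memNset//= (fz n x (width n))// => y xy.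
  split=> [/Acube/cubeP c|/Acube/cubeP c]; exfalso; apply: c3; apply/cubeP => i.
    by have /andP[? ?] := c i; apply/andP; split; lra.
  have /andP[? ?] := c i; have := coord3_sqd i x y.
  have /andP[_ ?] := width01 n.
  move=> hxy; have : (coord3 i x - coord3 i y) ^+ 2 < 1 by lra.
  move: (coord3 i x - coord3 i y) (subrK (coord3 i y) (coord3 i x)) => u <- hu.
  have u1 : u < 1 by nra.
  have u2 : -1 < u by nra.
  by apply/andP; split; lra.
have : (fun n => \int[leb3]_x f n x)%E @ \oo --> (\int[leb3]_(x in [set: mR3 R]) (cst 0 x))%E.
  have [] := @dominated_convergence _ _ _ (@leb3 R) setT measurableT f (cst 0%E)
    (fun x => (\1_(cube 3) x : R)%:E).
  - exact: mf.
  - exact: measurable_cst.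
  - exists N; split=> // x /= hx; apply: contrapT => Nx; apply: hx => _.
    have [e e0 he] := NA x Nx.
    apply: cvg_near_cst; near=> n; apply: (fz n x e he).
    by apply: ltW; near: n; exact: width_lt.
  - apply/integrableP; split.
      by apply/measurable_EFinP/measurable_indic; exact: measurable_cube.
    under eq_integral do rewrite gee0_abs ?lee_fin//.
    by rewrite int_indic3 ?leb3_cube ?ltry//; exact: measurable_cube.
  - by apply: aeW => x n _; rewrite gee0_abs.
  - by [].
rewrite integral0 => cv e e0.
have [M _ HM] := cv _ (open_ereal_lt' (e0 : (0 < e%:E)%E)).
by exists M => // n Mn /=; rewrite oscE; apply/ltW/HM.
Unshelve. all: by end_near. Qed.

Lemma indic_setU_disj A B : A `&` B = set0 ->
  \1_(A `|` B) = (fun x => \1_A x + \1_B x) :> (mR3 R -> R).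
Proof.
move=> AB; apply/funext => x; rewrite !indicE in_setU.
have := in_setI x A B; rewrite AB in_set0.
by case: (x \in A); case: (x \in B) => //=; rewrite ?addr0 ?add0r.
Qed.

(** Extension from sets with negligible boundary to all Borel subsets of a cube,
    by induction over the Dynkin system they generate. *)
Lemma vanosc_indic_cube A : measurable A -> vanosc \1_(A `&` cube 2).
Proof.
have mc := @measurable_cube R 2.
have mI (B : set (mR3 R)) : measurable B ->
    measurable_fun [set: mR3 R] (\1_B : mR3 R -> R) by exact: measurable_indic.
have vU (B C : set (mR3 R)) : measurable B -> measurable C -> B `&` C = set0 ->
    vanosc \1_B -> vanosc \1_C -> vanosc \1_(B `|` C).
  move=> mB mC BC vB vC; rewrite indic_setU_disj//.
  by apply: vanosc_add; [exact: mkern|exact: kern_ge0|exact: mI|exact: mI| |].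
suff : forall S, <<s @null_boundary R >> S -> vanosc \1_(S `&` cube 2).
  by move=> + mA; apply; rewrite -measurable_null_boundary.
apply: (dynkin_induction (@measurable_null_boundary R)).
- exact: null_boundaryI.
- rewrite setTI; apply: vanosc_null_boundary => //; exact: null_boundary_cube.
- move=> B nB; apply: vanosc_null_boundary; last exact: subIsetr.
  by apply: null_boundaryI => //; exact: null_boundary_cube.
- move=> S mS vS.
  have mSc : measurable (S `&` cube 2) by exact: measurableI.
  have -> : \1_(~` S `&` cube 2) =
      (fun x => \1_(cube 2) x + (-1) * \1_(S `&` cube 2) x) :> (mR3 R -> R).
    apply/funext => x; rewrite !indicE !in_setI in_setC.
    by case: (x \in S); case: (x \in cube 2) => /=; ring.
  apply: vanosc_add; [exact: mkern|exact: kern_ge0|exact: mI| | |].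
  + by apply: measurable_funM => //; exact: mI.
  + apply: vanosc_null_boundary => //; exact: null_boundary_cube.
  + by apply: vanosc_scale; [exact: mkern|exact: kern_ge0|exact: mI|].
- move=> F mF tF vF.
  pose U n := \bigcup_(k < n) F k.
  have mU n : measurable (U n) by apply: bigcup_measurable.
  have vUn n : vanosc \1_(U n `&` cube 2).
    elim: n => [|n IH].
      rewrite (_ : U 0%N = set0) ?set0I; last first.
        by apply/seteqP; split => // x [k].
      apply: vanosc_null_boundary => //; split => //.
      exists set0; split=> // x _; exists 1 => // y _; tauto.
    have -> : U n.+1 `&` cube 2 = (U n `&` cube 2) `|` (F n `&` cube 2).
      rewrite -setIUl; congr (_ `&` _); apply/seteqP; split => x.
        move=> [k /= kn Fk]; have [kn'|kn'] := ltnP k n; first by left; exists k.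
        right; suff -> : n = k by []. 
        by apply/eqP; rewrite eqn_leq kn' -ltnS kn.
      by move=> [[k /= kn Fk]|Fn]; [exists k => //=; exact: ltnW|exists n => /=].
    apply: vU => //; try exact: measurableI.
    apply/seteqP; split => // x [[[k /= kn Fk] _] [Fn _]].
    have kn' : k = n by apply: (tF k n) => //; exists x.
    by move: kn; rewrite kn' ltnn.
  have mF' : measurable (\bigcup_k F k) by exact: bigcup_measurable.
  pose D n := ((\bigcup_k F k) `\` U n) `&` cube 2.
  have mD n : measurable (D n) by apply: measurableI => //; exact: measurableD.
  have Dcap : \bigcap_n D n = set0.
    apply/seteqP; split => // x Dx; have [[[k _ Fk] _] _] := Dx 0%N I.
    by have [[_ +] _] := Dx k.+1 I; apply; exists k => /=.
  have D0 : (leb3 (D 0%N) < +oo)%E.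
    apply: (@le_lt_trans _ _ (leb3 (cube 2))); last by rewrite leb3_cube// ltry.
    by apply: le_measure; rewrite ?inE//; exact: subIsetr.
  have Dn : nonincreasing_seq D.
    move=> m n mn; apply/subsetPset => x [[Fx nU] cx]; split=> //; split=> //.
    by move=> [k /= km Fk]; apply: nU; exists k => //=; exact: leq_trans km mn.
  have cv : leb3 \o D @ \oo --> 0%E.
    have -> : 0%E = leb3 (\bigcap_n D n) by rewrite Dcap measure0.
    by apply: nonincreasing_cvg_mu => //; rewrite Dcap.
  have mFc : measurable (\bigcup_k F k `&` cube 2) by exact: measurableI.
  have mUc n : measurable (U n `&` cube 2) by exact: measurableI.
  apply: (vanosc_closed leb3 kern mkern kern_ge0 int_kern1 int_kern2).
    exact: mI.
  move=> e e0; have [M _ HM] := cv _ (open_ereal_lt' (e0 : (0 < e%:E)%E)).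
  exists \1_(U M `&` cube 2); split; [exact: mI|exact: vUn|].
  apply: le_trans (ltW (HM M (leqnn M))); rewrite /= -int_indic3//.
  apply: ge0_int_le.
  + by apply: measurable_funX; apply: measurable_funB; exact: mI.
  + exact: mI.
  + by move=> x; rewrite sqr_ge0.
  + move=> x; rewrite /D setDE; move: (cube 2) => Q.
    rewrite !indicE !in_setI in_setC.
    have UF : x \in U M -> x \in \bigcup_k F k.
      by move=> /set_mem[k _ Fk]; apply/mem_set; exists k.
    case: (x \in Q); rewrite ?andbF ?andbT ?subrr ?expr0n//=.
    case: (x \in U M) UF => [->//|_]; first by rewrite subrr expr0n.
    by case: (x \in _); rewrite ?subr0 ?expr1n ?expr0n.
Qed.

Lemma kern_pairing_cvg F G :
  measurable_fun [set: mR3 R] F -> measurable_fun [set: mR3 R] G ->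
  (L2n leb3 F < +oo)%E -> (L2n leb3 G < +oo)%E ->
  (forall x, ~ cube 2 x -> G x = 0) ->
  pairing leb3 kern n F G @[n --> \oo] --> \int[leb3]_x (F x * G x).
Proof.
move=> mF mG LF LG G0.
apply: (pairing_cvg leb3 kern mkern kern_ge0 int_kern1 int_kern2) => //.
apply: (vanosc_L2 leb3 kern mkern kern_ge0 int_kern1 int_kern2 (cube 2)) => //.
  exact: measurable_cube.
exact: vanosc_indic_cube.
Qed.

End MollifierSequence.

(** * Linearity of real integrals *)

Section HasIntegral.
Context {d} {T : measurableType d} {R : realType}.
Variable mu : {measure set T -> \bar R}.
Implicit Types (f g : T -> R) (a b k : R).

(** f is integrable with integral a. *)
Definition has_int f a : Prop :=
  mu.-integrable setT (EFin \o f) /\ \int[mu]_x f x = a.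

Lemma has_int_unique f a b : has_int f a -> has_int f b -> a = b.
Proof. by move=> [_ <-] [_ <-]. Qed.

Lemma eq_has_int f g a : f =1 g -> has_int f a -> has_int g a.
Proof. by move=> /funext ->. Qed.

Lemma has_int_add f g a b : has_int f a -> has_int g b ->
  has_int (fun x => f x + g x) (a + b).
Proof.
move=> [fi <-] [gi <-]; split; first exact: (integrableD measurableT fi gi).
exact: RintegralD.
Qed.

Lemma has_int_scale k f a : has_int f a -> has_int (fun x => k * f x) (k * a).
Proof.
move=> [fi <-]; split; last exact: RintegralZl.
exact: (integrableZl measurableT k fi).
Qed.

Lemma has_int_opp f a : has_int f a -> has_int (fun x => - f x) (- a).
Proof.
move=> /(has_int_scale (-1)); rewrite mulN1r; apply: eq_has_int => x.
by rewrite mulN1r.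
Qed.

Lemma has_int_sub f g a b : has_int f a -> has_int g b ->
  has_int (fun x => f x - g x) (a - b).
Proof. by move=> fa /has_int_opp gb; exact: has_int_add. Qed.

Lemma has_int_sum (I : Type) (r : seq I) (F : I -> T -> R) (a_ : I -> R) :
  (forall i, has_int (F i) (a_ i)) ->
  has_int (fun x => \sum_(i <- r) F i x) (\sum_(i <- r) a_ i).
Proof.
move=> H; elim: r => [|i r IH].
  rewrite big_nil; split; last by rewrite /Rintegral integral0_eq// => x _; rewrite big_nil.
  by apply: (eq_integrable measurableT) (integrable0 _ _) => // x _; rewrite /= big_nil.
rewrite big_cons; apply: eq_has_int (has_int_add _ _ _ _ (H i) IH) => x.
by rewrite big_cons.
Qed.

Lemma ae_has_int f g a : measurable_fun setT g ->
  {ae mu, forall x, f x = g x} -> has_int f a -> has_int g a.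
Proof.
move=> mg fg [fi fa].
have mf : measurable_fun setT f by apply/measurable_EFinP; exact: measurable_int fi.
have fgE : ae_eq mu setT (EFin \o f) (EFin \o g).
  by apply: filterS fg => x /= -> _.
split.
  apply/integrableP; split; first exact/measurable_EFinP.
  case/integrableP : fi => _; apply: le_lt_trans.
  rewrite le_eqVlt; apply/orP; left; apply/eqP.
  apply: ae_eq_integral => //.
  - by do 2 apply: measurableT_comp => //.
  - by do 2 apply: measurableT_comp => //.
  - by apply: filterS fg => x /= -> _.
rewrite -fa /Rintegral; congr fine; apply/esym; apply: ae_eq_integral => //.
- exact/measurable_EFinP.
- exact/measurable_EFinP.
Qed.

End HasIntegral.

(** * Fubini for square-integrable functions on a ball *)

Section LocalL2.
Context {R : realType}.
Local Notation has_int3 := (has_int (@leb3 R)).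
Local Notation Ball s := [set x : mR3 R | sqd 0 x <= s].
Implicit Types (f g h : R3 R -> R) (s : R).

Lemma measurable_Ball s : measurable (Ball s).
Proof.
rewrite (_ : Ball s = setT `&` sqd 0 @^-1` `]-oo, s]%classic).
  by apply: measurable_sqd.
by rewrite setTI; apply/seteqP; split => x /=; rewrite in_itv.
Qed.

(** Square-integrable functions on R^3 that vanish outside the ball of squared
    radius s. *)
Definition L2B s f := [/\ measurable_fun [set: mR3 R] f, (L2n (@leb3 R) f < +oo)%E &
  forall x, s < sqd 0 x -> f x = 0].

Lemma L2B_add s f g : L2B s f -> L2B s g -> L2B s (fun x => f x + g x).
Proof.
move=> [mf Lf f0] [mg Lg g0]; split.
- exact: measurable_funD.
- apply: (le_lt_trans (L2n_add _ _ _ mf mg)).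
  by rewrite lte_add_pinfty// lte_mul_pinfty.
- by move=> x xs; rewrite f0// g0// addr0.
Qed.

Lemma L2B_bounded s f h M : L2B s f -> measurable_fun [set: mR3 R] h ->
  (forall x, sqd 0 x <= s -> `|h x| <= M) -> L2B s (fun x => f x * h x).
Proof.
move=> [mf Lf f0] mh hM; split.
- exact: measurable_funM.
- apply: (@le_lt_trans _ _ (L2n (@leb3 R) (fun x => M * f x))).
    apply: ge0_int_le.
    + by apply: measurable_funX; exact: measurable_funM.
    + by apply: measurable_funX; exact: measurable_funM.
    + by move=> x; rewrite sqr_ge0.
    + move=> x; have [h1|h1] := leP (sqd 0 x) s; last by rewrite f0// mul0r mulr0.
      rewrite !exprMn mulrC ler_wpM2r ?sqr_ge0//.
      by rewrite -[X in X <= _]real_normK ?num_real// lerXn2r ?nnegrE// ?(le_trans _ (hM x h1))// hM.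
  rewrite L2n_scale// lte_mul_pinfty// ?lee_fin ?sqr_ge0//.
- by move=> x xs; rewrite f0// mul0r.
Qed.

Lemma L2B_tfun s f h : L2B s f -> tfun h -> L2B s (fun x => f x * h x).
Proof.
move=> Lf th; have [M hM] := tfun_bounded _ th s.
exact: (L2B_bounded _ _ _ M Lf (tfun_measurable _ th) hM).
Qed.

Lemma L2B_scale s k f : L2B s f -> L2B s (fun x => k * f x).
Proof.
move=> Lf; rewrite (_ : (fun x => _) = fun x => f x * (fun=> k) x).
  apply: L2B_tfun => //; exact: tfun_cst.
by apply/funext => x; rewrite mulrC.
Qed.

Lemma L2B_mul s f g : L2B s f -> L2B s g ->
  has_int3 (fun x => f x * g x) (\int[leb3]_x (f x * g x)).
Proof.
move=> [mf Lf _] [mg Lg _]; split=> //.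
exact: (L2_mul_integrable leb3 f g).
Qed.

Lemma L2B_indic s : s <= 1 -> L2B s \1_(Ball s).
Proof.
move=> s1; have mB := measurable_Ball s.
split; first exact: measurable_indic.
- rewrite /L2n; under eq_integral.
    move=> x _; rewrite (_ : _ ^+ 2 = \1_(Ball s) x); first over.
    by rewrite indicE; case: (_ \in _); rewrite ?expr1n ?expr0n.
  rewrite int_indic3//; apply: (@le_lt_trans _ _ (leb3 (cube 2))).
    apply: le_measure; rewrite ?inE//; first exact: measurable_cube.
    move=> x /= xs; apply/cubeP => i; have := coord3_sqd i 0 x.
    have -> : coord3 i (0 : R3 R) = 0 by elim/ord3_ind: i.
    rewrite sub0r sqrrN => h.
    have {}h : coord3 i x ^+ 2 <= 1 by lra.
    by apply/andP; split; nra.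
  by rewrite leb3_cube// ltry.
- move=> x xs; rewrite indicE memNset//= => h; lra.
Qed.

Lemma L2B_has_int3 s f : s <= 1 -> L2B s f -> has_int3 f (\int[leb3]_x f x).
Proof.
move=> s1 Lf; have := L2B_mul _ _ _ Lf (L2B_indic s s1).
case: Lf => _ _ f0.
suff -> : (fun x => f x * \1_(Ball s) x) = f by [].
apply/funext => x; rewrite indicE.
have [h|h] := boolP (x \in _); first by rewrite mulr1.
rewrite mulr0 f0// ltNge; apply/negP => h'; move/negP: h; apply.
exact/mem_set.
Qed.

Lemma kernel_Fubini_aux s f g (k : R3 R * R3 R -> R) M : s <= 1 ->
  L2B s f -> L2B s g -> measurable_fun [set: mR3 R * mR3 R] k ->
  (forall x y, sqd 0 x <= s -> sqd 0 y <= s -> `|k (x, y)| <= M) ->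
  let P := fine (\int[leb3 \x leb3]_z (k z * (f z.1 * g z.2))%:E)%E in
  has_int3 (fun x => f x * \int[leb3]_y (g y * k (x, y))) P /\
  \int[leb3]_y (g y * \int[leb3]_x (f x * k (x, y))) = P.
Proof.
move=> s1 Lf Lg mk kM P.
have [mf _ f0] := Lf; have [mg _ g0] := Lg.
have slice1 x : sqd 0 x <= s ->
    has_int3 (fun y => g y * k (x, y)) (\int[leb3]_y (g y * k (x, y))).
  move=> xs; apply: (L2B_has_int3 s) => //; apply: (L2B_bounded _ _ _ M) => //.
    exact: (measurableT_comp mk (pair1_measurable x)).
  by move=> y ys; exact: kM.
have slice2 y : sqd 0 y <= s ->
    has_int3 (fun x => f x * k (x, y)) (\int[leb3]_x (f x * k (x, y))).
  move=> ys; apply: (L2B_has_int3 s) => //; apply: (L2B_bounded _ _ _ M) => //.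
    exact: (measurableT_comp mk (pair2_measurable y)).
  by move=> x xs; exact: kM.
pose h z : \bar R := (k z * (f z.1 * g z.2))%:E.
have F1 x : (f x * \int[leb3]_y (g y * k (x, y)))%:E = fubini_F (@leb3 R) h x.
  rewrite /fubini_F /h /=; have [xs|xs] := leP (sqd 0 x) s; last first.
    rewrite f0// mul0r integral0_eq// => y _; by rewrite mul0r mulr0.
  have [i e] := slice1 x xs.
  rewrite EFinM /Rintegral fineK; last exact: (integrable_fin_num measurableT i).
  rewrite -(integralZl measurableT i).
  by apply: eq_integral => y _ /=; rewrite -EFinM; congr EFin; ring.
have F2 y : (g y * \int[leb3]_x (f x * k (x, y)))%:E = fubini_G (@leb3 R) h y.
  rewrite /fubini_G /h /=; have [ys|ys] := leP (sqd 0 y) s; last first.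
    rewrite g0// mul0r integral0_eq// => x _; by rewrite !mulr0.
  have [i e] := slice2 y ys.
  rewrite EFinM /Rintegral fineK; last exact: (integrable_fin_num measurableT i).
  rewrite -(integralZl measurableT i).
  by apply: eq_integral => x _ /=; rewrite -EFinM; congr EFin; ring.
have mfg : measurable_fun [set: mR3 R * mR3 R] (fun z => f z.1 * g z.2).
  apply: measurable_funM.
    exact: (measurableT_comp mf measurable_fst).
  exact: (measurableT_comp mg measurable_snd).
have mh : measurable_fun setT h by apply/measurable_EFinP; exact: measurable_funM.
have ih : (leb3 \x leb3)%E.-integrable setT h.
  have [/integrableP[_ ff] _] := L2B_has_int3 _ _ s1 Lf.
  have [/integrableP[_ gf] _] := L2B_has_int3 _ _ s1 Lg.
  have mnf : measurable_fun setT (fun x => `|f x|) by exact: measurableT_comp.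
  have mng : measurable_fun setT (fun x => `|g x|) by exact: measurableT_comp.
  pose A := fine (\int[leb3]_y `|g y|%:E)%E.
  have AE : (\int[leb3]_y `|g y|%:E = A%:E)%E.
    by rewrite /A fineK// ge0_fin_numE// integral_ge0.
  have A0 : 0 <= A by rewrite /A fine_ge0// integral_ge0.
  have M0 : 0 <= Num.max M 0 by rewrite le_max lexx orbT.
  apply/integrable12ltyP => //.
  apply: (@le_lt_trans _ _ (\int[leb3]_x ((Num.max M 0 * A) * `|f x|)%:E)%E); last first.
    rewrite ge0_int_scale//; last exact: mulr_ge0.
    by rewrite lte_mul_pinfty// lee_fin mulr_ge0.
  apply: ge0_le_integral => //.
  - by move=> x _; apply: integral_ge0.
  - suff : measurable_fun setT (fubini_F (@leb3 R) (abse \o h)) by [].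
    apply: measurable_fun_fubini_tonelli_F; first exact: measurableT_comp.
    by move=> z; exact: abse_ge0.
  - by apply/measurable_EFinP; apply: measurable_funM.
  - move=> x _.
    rewrite (mulrAC _ A) EFinM -AE -ge0_int_scale//; last exact: mulr_ge0.
    apply: (@ge0_int_le _ _ _ (@leb3 R) (fun y : mR3 R => `|k (x, y) * (f x * g y)|)
      (fun y : mR3 R => Num.max M 0 * `|f x| * `|g y|)) => //.
    + apply: measurableT_comp => //.
      exact: (measurableT_comp (measurable_funM mk mfg) (pair1_measurable x)).
    + exact: measurable_funM.
    + move=> y; rewrite -mulrA !normrM.
      have [xs|xs] := leP (sqd 0 x) s; last by rewrite f0// normr0 mul0r !mulr0.
      have [ys|ys] := leP (sqd 0 y) s; last by rewrite g0// normr0 !mulr0.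
      by rewrite ler_wpM2r ?mulr_ge0// le_max kM.
split; [split|].
- rewrite (_ : EFin \o _ = fubini_F (@leb3 R) h); last exact/funext.
  exact: integrable_fubini_F.
- rewrite /Rintegral; under eq_integral do rewrite F1.
  by rewrite (integral12_prod_meas1 ih).
- rewrite /Rintegral; under eq_integral do rewrite F2.
  by rewrite (integral21_prod_meas1 ih).
Qed.

(** The inner integrals are finite at every point of the ball, because the
    kernel is bounded there, and the outer factor vanishes elsewhere. *)
Lemma kernel_Fubini s f g (k : R3 R * R3 R -> R) M : s <= 1 ->
  L2B s f -> L2B s g -> measurable_fun [set: mR3 R * mR3 R] k ->
  (forall x y, sqd 0 x <= s -> sqd 0 y <= s -> `|k (x, y)| <= M) ->
  let P := fine (\int[leb3 \x leb3]_z (k z * (f z.1 * g z.2))%:E)%E in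
  has_int3 (fun x => f x * \int[leb3]_y (g y * k (x, y))) P /\
  has_int3 (fun y => g y * \int[leb3]_x (f x * k (x, y))) P.
Proof.
move=> s1 Lf Lg mk kM P; have [h1 e2] := kernel_Fubini_aux s f g k M s1 Lf Lg mk kM.
split=> //; split=> //.
have mk' : measurable_fun [set: mR3 R * mR3 R] (fun z => k (z.2, z.1)).
  exact: (measurableT_comp mk (measurable_swap (T1 := mR3 R) (T2 := mR3 R))).
have kM' x y : sqd 0 x <= s -> sqd 0 y <= s -> `|k (y, x)| <= M.
  by move=> xs ys; exact: kM.
by have [[]] := kernel_Fubini_aux s g f (fun z => k (z.2, z.1)) M s1 Lg Lf mk' kM'.
Qed.

End LocalL2.

(** * Derivatives of the mollifier *)

Section KernelDerivatives.
Context {R : realType}.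
Variable delta : R.
Hypothesis delta01 : 0 < delta <= 1.
Implicit Types (x y : R3 R) (i j : 'I_3).
Local Notation kern := (kern delta).
Local Notation w := (width delta).

Lemma bump_mass_width_gt0 n : 0 < fine (bump_mass (w n)).
Proof.
have d01 := width01 delta delta01 n; have Z0 := bump_mass_gt0 _ d01.
have Zf : (bump_mass (w n) < +oo)%E.
  by apply: bump_mass_lty; case/andP: d01 => /ltW -> ->.
by rewrite -lte_fin fineK// ge0_fin_numE// ltW.
Qed.

(** The derivative of the mollifier in its first variable (partial3_kern); it is
    the opposite of the derivative in the second one (partial3_kern2). *)
Definition dkern n i (z : R3 R * R3 R) : R :=
  - (2 * (coord3 i z.1 - coord3 i z.2)) *
  (flat 2 (w n - sqd z.2 z.1) / fine (bump_mass (w n))).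

Lemma tfun_scaled m n y : tfun (fun x => flat m (w n - sqd y x) / fine (bump_mass (w n))).
Proof. by apply: tfun_mul; [exact: tfun_bump|exact: tfun_cst]. Qed.

Lemma tfun_kern n y : tfun (fun x => kern n (x, y)).
Proof. exact: tfun_scaled. Qed.

Lemma tfun_kern2 n x : tfun (fun y => kern n (x, y)).
Proof. by under eq_fun do rewrite /kern kapC; exact: tfun_kern. Qed.

Lemma tfun_linear i y (k : R) : tfun (fun x => k * (coord3 i x - coord3 i y)).
Proof.
by apply: tfun_mul; [|apply: tfun_sub]; (exact: tfun_cst || exact: tfun_coord).
Qed.

Lemma dkernE n i y : (fun x => dkern n i (x, y)) = (fun x =>
   (- 2 * (coord3 i x - coord3 i y)) * (flat 2 (w n - sqd y x) / fine (bump_mass (w n)))).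
Proof. by apply/funext => x; rewrite /dkern/= mulNr. Qed.

Lemma tfun_dkern n i y : tfun (fun x => dkern n i (x, y)).
Proof.
by rewrite dkernE; apply: tfun_mul; [exact: tfun_linear|exact: tfun_scaled].
Qed.

Lemma partial3_linear i j y (k : R) :
  partial3 j (fun x => k * (coord3 i x - coord3 i y)) = fun=> k * (j == i)%:R.
Proof.
have t : tfun (fun x => coord3 i x - coord3 i y).
  by apply: tfun_sub; (exact: tfun_cst || exact: tfun_coord).
rewrite partial3_mul//; last exact: tfun_cst.
rewrite partial3_cst partial3_add; [|exact: tfun_coord|exact: tfun_cst].
by rewrite partial3_coord partial3_cst; apply/funext => x; rewrite mul0r add0r addr0.
Qed.

Lemma partial3_scaled i m n y :
  partial3 i (fun x => flat m (w n - sqd y x) / fine (bump_mass (w n))) =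
  fun x => - (2 * (coord3 i x - coord3 i y)) *
   ((flat m.+2 (w n - sqd y x) - m%:R * flat m.+1 (w n - sqd y x)) / fine (bump_mass (w n))).
Proof.
have t : tfun (fun x => w n - sqd y x).
  by apply: tfun_sub; [exact: tfun_cst|exact: tfun_sqd].
have d : partial3 i (fun x => w n - sqd y x) = fun x => - (2 * (coord3 i x - coord3 i y)).
  rewrite (_ : (fun x => _) = fun x => w n + -1 * sqd y x); last first.
    by apply/funext => x; rewrite mulN1r.
  have ts : tfun (fun x => -1 * sqd y x).
    by apply: tfun_mul; [exact: tfun_cst|exact: tfun_sqd].
  rewrite partial3_add//; last exact: tfun_cst.
  rewrite (partial3_mul i _ _ (tfun_cst (-1)) (tfun_sqd y)).
  rewrite !partial3_cst partial3_sqd; apply/funext => x.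
  by rewrite mul0r !add0r mulN1r.
rewrite partial3_mul; [|exact: tfun_flat|exact: tfun_cst].
rewrite partial3_flat// partial3_cst d; apply/funext => x.
by ring.
Qed.

Lemma partial3_kern n i y :
  partial3 i (fun x => kern n (x, y)) = fun x => dkern n i (x, y).
Proof.
rewrite [LHS](partial3_scaled i 0 n y); apply/funext => x.
by rewrite /dkern mul0r subr0.
Qed.

Lemma partial3_kern2 n i x :
  partial3 i (fun y => kern n (x, y)) = fun y => - dkern n i (x, y).
Proof.
under eq_fun do rewrite /kern kapC.
rewrite -/(kern n) partial3_kern; apply/funext => y.
by rewrite /dkern/= sqdC; ring.
Qed.

(** Second derivatives of the mollifier commute; this is what makes the
    identity weak_deriv_curl exact at every scale. *)
Lemma partial3_dkernC n i j y :
  partial3 j (fun x => dkern n i (x, y)) = partial3 i (fun x => dkern n j (x, y)).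
Proof.
have h k l : partial3 l (fun x => dkern n k (x, y)) = fun x =>
    - 2 * (l == k)%:R * (flat 2 (w n - sqd y x) / fine (bump_mass (w n))) +
    - 2 * (coord3 k x - coord3 k y) * (- (2 * (coord3 l x - coord3 l y)) *
     ((flat 4 (w n - sqd y x) - 2 * flat 3 (w n - sqd y x)) / fine (bump_mass (w n)))).
  rewrite dkernE (partial3_mul l _ _ (tfun_linear k y (- 2)) (tfun_scaled 2 n y)).
  by rewrite partial3_linear partial3_scaled.
by rewrite !h; apply/funext => x; rewrite eq_sym; ring.
Qed.

Lemma measurable_dkern n i : measurable_fun [set: mR3 R * mR3 R] (dkern n i).
Proof.
apply: measurable_funM; last first.
  by apply: measurable_funM => //; exact: measurable_bump2.
apply: measurable_funN; apply: measurable_funM => //; apply: measurable_funB.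
  exact: (measurableT_comp (@measurable_coord3 R i) measurable_fst).
exact: (measurableT_comp (@measurable_coord3 R i) measurable_snd).
Qed.

Lemma kern_bounded n z : `|kern n z| <= (fine (bump_mass (w n)))^-1.
Proof.
rewrite ger0_norm ?kern_ge0// -[leRHS]mul1r ler_wpM2r ?bump_le1//.
by rewrite invr_ge0 ltW// bump_mass_width_gt0.
Qed.

Lemma coord3_0 i : coord3 i (0 : R3 R) = 0.
Proof. by elim/ord3_ind: i. Qed.

Lemma dkern_bounded n i x y : sqd 0 x <= 1 -> sqd 0 y <= 1 ->
  `|dkern n i (x, y)| <= 16 / fine (bump_mass (w n)).
Proof.
move=> x1 y1; have Z0 := bump_mass_width_gt0 n.
have c (u : R3 R) : sqd 0 u <= 1 -> - 1 <= coord3 i u <= 1.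
  move=> u1; have := coord3_sqd i 0 u; rewrite coord3_0 sub0r sqrrN sqdC => h.
  have {}h : coord3 i u ^+ 2 <= 1 by rewrite sqdC in h; lra.
  by apply/andP; split; nra.
rewrite /dkern/= mulrA !normrM normfV (gtr0_norm Z0) normrN normrM.
rewrite ler_wpM2r ?invr_ge0 ?(ltW Z0)//.
rewrite (ger0_norm (flat_ge0 _ _)) (ger0_norm (_ : 0 <= 2))//.
have := flat_le 2 (w n - sqd y x); have := flat_ge0 2 (w n - sqd y x).
have : `|coord3 i x - coord3 i y| <= 2.
  have /andP[? ?] := c _ x1; have /andP[? ?] := c _ y1.
  by rewrite ler_norml; apply/andP; split; lra.
have := normr_ge0 (coord3 i x - coord3 i y).
move: (flat _ _) `|_| => a b b0 b2 a0; rewrite expr2 => a4; nra.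
Qed.

Lemma kern_eq0 n x y : w n <= sqd y x -> kern n (x, y) = 0.
Proof. exact: kap_eq0. Qed.

Lemma dkern_eq0 n i x y : w n <= sqd y x -> dkern n i (x, y) = 0.
Proof. by move=> h; rewrite /dkern/= bump_eq0// mul0r mulr0. Qed.

End KernelDerivatives.

(** * Calculus of weak derivatives *)

Section WeakDerivatives.
Context {R : realType}.
Local Notation has_int3 := (has_int (@leb3 R)).
Local Notation Int f := (\int[@leb3 R]_x f x).
Variable s : R.
Hypothesis s01 : 0 < s <= 1.
Implicit Types (f g h : R3 R -> R) (i j b c : 'I_3) (x y : R3 R).

Let s0 : 0 < s. Proof. by case/andP: s01. Qed.
Let s1 : s <= 1. Proof. by case/andP: s01. Qed.

(** f vanishes where the squared Euclidean norm is at least t. *)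
Definition vanish_off (t : R) f := forall x, t <= sqd 0 x -> f x = 0.

(** g is the weak i-th derivative of f inside the ball of squared radius s.
    Both functions are extended by 0 and tested against functions of the class
    tfun that vanish outside the ball. *)
Definition weak_deriv i f g := [/\ L2B s f, L2B s g &
  forall psi, tfun psi -> vanish_off s psi ->
    Int (fun x => f x * partial3 i psi x) = - Int (fun x => g x * psi x)].

(** The largest squared radius of the mollifiers.  With this choice the
    mollifiers centred in the ball of squared radius s / 4 vanish outside the ball
    of squared radius s, and those centred in the ball of squared radius s / 16
    vanish outside the ball of squared radius s / 4. *)
Definition delta : R := s / 16.

Lemma delta01 : 0 < delta <= 1.
Proof. by rewrite /delta; apply/andP; split; have := s0; have := s1; lra. Qed.

Local Notation kern := (kern delta).
Local Notation dkern := (dkern delta).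

Lemma sqd_triangle x y : sqd 0 y <= 2 * sqd 0 x + 2 * sqd x y.
Proof.
rewrite /sqd /= !subr0.
have t (p q : R) : q ^+ 2 <= 2 * p ^+ 2 + 2 * (q - p) ^+ 2.
  by have := sqr_ge0 (q - 2 * p); nra.
have := t x.1.1 y.1.1; have := t x.1.2 y.1.2; have := t x.2 y.2; lra.
Qed.

Lemma kern_far (t : R) n x y : 4 * delta <= t -> sqd 0 x <= t / 4 -> t <= sqd 0 y ->
  width delta n <= sqd x y.
Proof.
move=> dt xt yt; have := sqd_triangle x y; have := width_le delta delta01 n; lra.
Qed.

Lemma has_int3_mul f h : L2B s f -> L2B s h -> has_int3 (fun x => f x * h x) (Int (fun x => f x * h x)).
Proof. exact: L2B_mul. Qed.

Lemma has_int3_tfun f h : L2B s f -> tfun h -> has_int3 (fun x => f x * h x) (Int (fun x => f x * h x)).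
Proof. by move=> Lf th; apply: (L2B_has_int3 s) => //; exact: L2B_tfun. Qed.

(** The derivative of the mollification is the mollification of the weak
    derivative. *)
Lemma weak_deriv_mollify i f g n x : weak_deriv i f g -> sqd 0 x <= s / 4 ->
  Int (fun y => f y * dkern n i (x, y)) = Int (fun y => g y * kern n (x, y)).
Proof.
move=> [Lf Lg fg] xs.
have v : vanish_off s (fun y => kern n (x, y)).
  move=> y ys; rewrite kern_eq0// sqdC; apply: (kern_far s) => //.
  by rewrite /delta; have := s0; lra.
have := fg _ (tfun_kern2 delta n x) v.
rewrite partial3_kern2.
have t : tfun (fun y => - dkern n i (x, y)).
  by rewrite -partial3_kern2; apply: tfun_partial; exact: tfun_kern2.
have := has_int3_tfun _ _ Lf t => /[swap] -> /(has_int_opp leb3); rewrite opprK => H.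
suff [] : has_int3 (fun y => f y * dkern n i (x, y)) (Int (fun y => g y * kern n (x, y))).
  by [].
by apply: eq_has_int H => y; rewrite mulrN opprK.
Qed.

Lemma weak_deriv_kern_bound x y n : sqd 0 x <= s -> sqd 0 y <= s ->
  `|kern n (x, y)| <= (fine (bump_mass (width delta n)))^-1.
Proof. by move=> _ _; exact/kern_bounded/delta01. Qed.

Lemma weak_deriv_dkern_bound i x y n : sqd 0 x <= s -> sqd 0 y <= s ->
  `|dkern n i (x, y)| <= 16 / fine (bump_mass (width delta n)).
Proof.
by move=> xs ys; apply: dkern_bounded; [exact: delta01|exact: le_trans s1|exact: le_trans s1].
Qed.

Local Notation pair := (pairing (@leb3 R) kern).

Lemma pair_has_int31 f g n : L2B s f -> L2B s g ->
  has_int3 (fun x => f x * Int (fun y => g y * kern n (x, y))) (pair n f g).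
Proof.
move=> Lf Lg.
have [H _] := kernel_Fubini s f g (kern n) _ s1 Lf Lg (mkern delta n)
  (fun x y => weak_deriv_kern_bound x y n).
exact: H.
Qed.

Lemma pair_has_int32 f g n : L2B s f -> L2B s g ->
  has_int3 (fun y => g y * Int (fun x => f x * kern n (x, y))) (pair n f g).
Proof.
move=> Lf Lg.
have [_ H] := kernel_Fubini s f g (kern n) _ s1 Lf Lg (mkern delta n)
  (fun x y => weak_deriv_kern_bound x y n).
exact: H.
Qed.

(** The identity weak_deriv_mollify, integrated against a function h supported in the
    smaller ball. *)
Lemma pair_dkern i f g h n : weak_deriv i f g -> L2B s h ->
  (forall x, s / 4 < sqd 0 x -> h x = 0) ->
  has_int3 (fun y => f y * Int (fun x => h x * dkern n i (x, y))) (pair n h g).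
Proof.
move=> fg Lh h0; have [Lf Lg _] := fg.
have [H1 H2] := kernel_Fubini s h f (dkern n i) _ s1 Lh Lf (measurable_dkern delta n i)
  (fun x y => weak_deriv_dkern_bound i x y n).
suff <- : fine (\int[leb3 \x leb3]_z (dkern n i z * (h z.1 * f z.2))%:E) = pair n h g.
  exact: H2.
apply: (has_int_unique _ _ _ _ H1); apply: eq_has_int (pair_has_int31 h g n Lh Lg) => x.
have [xs|xs] := leP (sqd 0 x) (s / 4); last by rewrite h0// !mul0r.
by rewrite (weak_deriv_mollify i f g).
Qed.

Lemma cube2_L2B f : L2B s f -> forall x, ~ cube 2 x -> f x = 0.
Proof.
move=> [_ _ f0] x cx; apply: f0; rewrite ltNge; apply/negP => xs; apply: cx.
apply/cubeP => i; have := coord3_sqd i 0 x; rewrite coord3_0 sub0r sqrrN => h.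
have := s1; move: (coord3 i x) h => t h ?.
have {}h : t ^+ 2 <= 1 by lra.
by apply/andP; split; nra.
Qed.

Lemma pair_cvg f g : L2B s f -> L2B s g ->
  pair n f g @[n --> \oo] --> Int (fun x => f x * g x).
Proof.
move=> [mf Lf _] Lg; have g0 := cube2_L2B _ Lg; have [mg LLg _] := Lg.
exact: kern_pairing_cvg delta01 _ _ _ _ _ _ _.
Qed.

Lemma cvg_eq0 (u : nat -> R) (l : R) : u n @[n --> \oo] --> l ->
  (forall n, u n = 0) -> l = 0.
Proof.
move=> ul u0; have e : u = fun=> 0 by exact/funext.
apply: (cvg_unique (@norm_hausdorff _ _) ul); rewrite e; exact: cvg_cst.
Qed.

Lemma vanish_off_partial (t : R) i f : tfun f -> vanish_off t f ->
  forall x, t < sqd 0 x -> partial3 i f x = 0.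
Proof.
move=> tf f0 x xt; rewrite /partial3 (near_eq_derive (g := cst 0)) ?derive_cst//.
have cq : {for x, continuous (sqd (0 : R3 R))}.
  exact/differentiable_continuous/tfun_diff/tfun_sqd.
have : \forall z \near x, t < sqd 0 z.
  exact: (cvgr_gt (sqd 0 x) cq _ xt).
by apply: filterS => z zt; rewrite f0// ltW.
Qed.

(** The derivative of a product of two H^1 functions.  For fixed y, the product
    of phi with the mollifier centred at y is a test function for h; integrating
    the resulting relation against f gives the statement at every finite scale,
    and pair_cvg passes to the limit. *)
Lemma weak_deriv_leibniz i f f' h h' phi : weak_deriv i f f' -> weak_deriv i h h' ->
  tfun phi -> vanish_off (s / 4) phi ->
  Int (fun x => (h x * partial3 i phi x) * f x) + Int (fun x => (h x * phi x) * f' x)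
   + Int (fun x => (h' x * phi x) * f x) = 0.
Proof.
move=> wf wh tphi phi0; have [Lf Lf' _] := wf; have [Lh Lh' hh'] := wh.
have tdphi := tfun_partial i _ tphi.
have Lhd := L2B_tfun s _ _ Lh tdphi.
have Lhp := L2B_tfun s _ _ Lh tphi.
have Lh'p := L2B_tfun s _ _ Lh' tphi.
apply: (cvg_eq0 (fun n => pair n (fun x => h x * partial3 i phi x) f +
    pair n (fun x => h x * phi x) f' + pair n (fun x => h' x * phi x) f)).
  by apply: cvgD; [apply: cvgD|]; exact: pair_cvg.
move=> n.
have z0 x : s / 4 < sqd 0 x -> h x * phi x = 0.
  by move=> xs; rewrite phi0 ?mulr0// ltW.
have H1 := pair_has_int32 _ _ n Lhd Lf.
have H2 := pair_dkern _ _ _ _ n wf Lhp z0.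
have H3 := pair_has_int32 _ _ n Lh'p Lf.
have := has_int_add _ _ _ _ _ (has_int_add _ _ _ _ _ H1 H2) H3.
move=> H; apply: (has_int_unique _ _ _ _ H).
have := has_int_scale _ 0 _ _ H1; rewrite mul0r; apply: eq_has_int => y.
rewrite mul0r -!mulrDr.
have v : vanish_off s (fun x => phi x * kern n (x, y)).
  by move=> x xs; rewrite phi0 ?mul0r//; have := s0; lra.
have tk := tfun_kern delta n y.
have := hh' _ (tfun_mul _ _ tphi tk) v.
rewrite (partial3_mul i _ _ tphi tk) partial3_kern => E.
have td := tfun_dkern delta n i y.
have G1 := has_int3_tfun _ _ Lhd tk.
have G2 := has_int3_tfun _ _ Lhp td.
have G3 := has_int3_tfun _ _ Lh'p tk.
have [_ G1'] := G1; have [_ G2'] := G2; have [_ G3'] := G3.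
suff -> : Int (fun x => h x * partial3 i phi x * kern n (x, y)) +
    Int (fun x => h x * phi x * dkern n i (x, y)) +
    Int (fun x => h' x * phi x * kern n (x, y)) = 0 by rewrite mulr0.
apply/eqP; rewrite addr_eq0; apply/eqP.
have [_ <-] := has_int_add _ _ _ _ _ G1 G2.
rewrite (_ : (fun x => _) = fun x => h x *
  (partial3 i phi x * kern n (x, y) + phi x * dkern n i (x, y))); last first.
  by apply/funext => x; ring.
by rewrite E; congr (- _); apply: eq_Rintegral => x _; ring.
Qed.

(** Formally, the integral of phi times the 2-form df wedge dh is minus the
    integral of h times df wedge dphi, because d (h df) = dh wedge df.  At finite
    scale the test functions are phi times a first derivative of the mollifier,
    and the second derivatives of the mollifier cancel. *)
Lemma weak_deriv_curl b c f fb fc h hb hc phi : weak_deriv b f fb -> weak_deriv c f fc ->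
  weak_deriv b h hb -> weak_deriv c h hc -> tfun phi -> vanish_off (s / 4) phi ->
  Int (fun x => (h x * partial3 c phi x) * fb x) -
  Int (fun x => (h x * partial3 b phi x) * fc x) +
  (Int (fun x => (hc x * phi x) * fb x) - Int (fun x => (hb x * phi x) * fc x)) = 0.
Proof.
move=> wfb wfc whb whc tphi phi0; have [Lf Lfb _] := wfb; have [_ Lfc _] := wfc.
have [Lh Lhb hhb] := whb; have [_ Lhc hhc] := whc.
have tdb := tfun_partial b _ tphi; have tdc := tfun_partial c _ tphi.
have Lhdb := L2B_tfun s _ _ Lh tdb; have Lhdc := L2B_tfun s _ _ Lh tdc.
have Lhp := L2B_tfun s _ _ Lh tphi.
have Lhbp := L2B_tfun s _ _ Lhb tphi; have Lhcp := L2B_tfun s _ _ Lhc tphi.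
apply: (cvg_eq0 (fun n => pair n (fun x => h x * partial3 c phi x) fb -
    pair n (fun x => h x * partial3 b phi x) fc +
    (pair n (fun x => hc x * phi x) fb - pair n (fun x => hb x * phi x) fc))).
  by apply: cvgD; apply: cvgB; exact: pair_cvg.
move=> n.
have z0 (k : R3 R -> R) x : s / 4 < sqd 0 x -> k x * phi x = 0.
  by move=> xs; rewrite phi0 ?mulr0// ltW.
have zd i x : s / 4 < sqd 0 x -> h x * partial3 i phi x = 0.
  by move=> xs; rewrite (vanish_off_partial (s / 4))// mulr0.
have H1 := pair_dkern _ _ _ _ n wfb Lhdc (zd c).
have H2 := pair_dkern _ _ _ _ n wfc Lhdb (zd b).
have H3 := pair_dkern _ _ _ _ n wfb Lhcp (z0 hc).
have H4 := pair_dkern _ _ _ _ n wfc Lhbp (z0 hb).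
have H := has_int_add _ _ _ _ _ (has_int_sub _ _ _ _ _ H1 H2)
  (has_int_sub _ _ _ _ _ H3 H4).
apply: (has_int_unique _ _ _ _ H).
have := has_int_scale _ 0 _ _ H1; rewrite mul0r; apply: eq_has_int => y.
rewrite mul0r -!mulrBr -mulrDr.
have v i : vanish_off s (fun x => phi x * dkern n i (x, y)).
  by move=> x xs; rewrite phi0 ?mul0r//; have := s0; lra.
have tk i := tfun_dkern delta n i y.
have E i j k k' : weak_deriv j k k' -> Int (fun x => k x * partial3 j phi x * dkern n i (x, y)) +
    Int (fun x => k x * phi x * partial3 j (fun x => dkern n i (x, y)) x) =
    - Int (fun x => k' x * phi x * dkern n i (x, y)).
  move=> [Lk Lk' kk']; have := kk' _ (tfun_mul _ _ tphi (tk i)) (v i).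
  rewrite (partial3_mul j _ _ tphi (tk i)) => Ek.
  have tdk : tfun (partial3 j (fun x => dkern n i (x, y))) by exact: tfun_partial.
  have G1 := has_int3_tfun _ _ (L2B_tfun s _ _ Lk (tfun_partial j _ tphi)) (tk i).
  have G2 := has_int3_tfun _ _ (L2B_tfun s _ _ Lk tphi) tdk.
  have [_ <-] := has_int_add _ _ _ _ _ G1 G2.
  transitivity (- Int (fun x => k' x * (phi x * dkern n i (x, y)))).
    by rewrite -Ek; apply: eq_Rintegral => x _; rewrite -!mulrA -mulrDr.
  by congr (- _); apply: eq_Rintegral => x _; rewrite mulrA.
have E1 := E b c h hc whc; have E2 := E c b h hb whb.
rewrite (partial3_dkernC delta n b c y) in E1.
rewrite [X in f y * X](_ : _ = 0) ?mulr0//.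
move: E1 E2; lra.
Qed.

(** The kernel derivative is odd under the reflection exchanging x and
    2 y - x. *)
Lemma int_dkern0 n i y : sqd 0 y <= s / 4 ->
  has_int3 (fun x => dkern n i (x, y)) 0.
Proof.
move=> ys.
(* The reflection exchanges the positive and the negative part. *)
pose p x := Num.max (dkern n i (x, y)) 0.
pose m x := Num.max (- dkern n i (x, y)) 0.
have mk : measurable_fun [set: mR3 R] (fun x => dkern n i (x, y)).
  exact: (measurableT_comp (measurable_dkern delta n i) (pair2_measurable y)).
have mp : measurable_fun [set: mR3 R] p by exact: measurable_maxr.
have mm : measurable_fun [set: mR3 R] m.
  by apply: measurable_maxr => //; exact: measurable_funN.
have k0 x : s < sqd 0 x -> dkern n i (x, y) = 0.
  move=> xs; rewrite dkern_eq0//; apply: (kern_far s) => //; last exact: ltW.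
  by rewrite /delta; have := s0; lra.
have ys' : sqd 0 y <= s by have := s0; lra.
have hb (q : R3 R -> R) : measurable_fun [set: mR3 R] q ->
    (forall x, `|q x| <= `|dkern n i (x, y)|) -> has_int3 q (Int q).
  move=> mq hq; have q0 x : s < sqd 0 x -> q x = 0.
    by move=> /k0 e; have := hq x; rewrite e normr0 normr_le0 => /eqP.
  suff e : (fun x => \1_[set x | sqd 0 x <= s] x * q x) = q.
    rewrite -e; apply: (L2B_has_int3 s) => //.
    apply: (L2B_bounded _ _ _ (16 / fine (bump_mass (width delta n)))) => //.
    - exact: L2B_indic.
    - by move=> x xs; apply: le_trans (hq x) _; exact: weak_deriv_dkern_bound.
  apply/funext => x; rewrite indicE.
  have [xs|xs] := leP (sqd 0 x) s; first by rewrite mem_set ?mul1r.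
  by rewrite q0// mulr0.
have hp : has_int3 p (Int p).
  apply: hb => // x; rewrite /p; case: (leP (dkern n i (x, y)) 0) => // _.
  by rewrite normr0.
have hm : has_int3 m (Int m).
  apply: hb => // x; rewrite /m; case: (leP (- dkern n i (x, y)) 0) => // _.
    by rewrite normr0.
  by rewrite normrN.
have epm : Int p = Int m.
  rewrite /Rintegral; congr fine.
  rewrite -(ge0_integral_refl3 (y + y) (fun x => (p x)%:E)).
  - apply: eq_integral => x _; congr EFin; rewrite /p /m; congr (Num.max _ 0).
    rewrite /dkern/=.
    have -> : sqd y (refl3 (y + y) x) = sqd y x by rewrite /sqd /=; ring.
    have -> : coord3 i (refl3 (y + y) x) = coord3 i y + coord3 i y - coord3 i x.
      by elim/ord3_ind: i {mk k0 hb hp hm mp mm p m}.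
    ring.
  - exact/measurable_EFinP.
  - by move=> x; rewrite lee_fin /p le_max lexx orbT.
have := has_int_sub _ _ _ _ _ hp hm; rewrite epm subrr; apply: eq_has_int => x.
rewrite /p /m; case: (leP (dkern n i (x, y)) 0) => h;
  case: (leP (- dkern n i (x, y)) 0) => h'; lra.
Qed.

(** The fundamental lemma of the calculus of variations: testing against
    mollifiers is enough, since the pairings of V with its restriction to the
    smaller ball are all 0 and converge to the squared norm of the restriction. *)
Lemma fundamental_lemma (t : R) V : t <= s -> L2B s V ->
  (forall n y, sqd 0 y <= t -> Int (fun x => V x * kern n (x, y)) = 0) ->
  {ae leb3, forall x : mR3 R, sqd 0 x <= t -> V x = 0}.
Proof.
move=> ts LV V0.
pose G x := V x * \1_[set x | sqd 0 x <= t] x.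
have LG : L2B s G.
  apply: (L2B_bounded _ _ _ 1) => //; first by apply: measurable_indic; exact: measurable_Ball.
  by move=> x _; rewrite indicE; case: (_ \in _); rewrite ?normr1 ?normr0.
have GV x : V x * G x = G x ^+ 2.
  rewrite /G indicE; case: (_ \in _); rewrite ?mulr1 ?mulr0 ?expr2 ?mulr0//.
have iVG : Int (fun x => V x * G x) = 0.
  apply: (cvg_eq0 (fun n => pair n V G)); first exact: pair_cvg.
  move=> n; have H := pair_has_int32 _ _ n LV LG.
  apply: (has_int_unique _ _ _ _ H).
  have := has_int_scale _ 0 _ _ H; rewrite mul0r; apply: eq_has_int => y.
  rewrite mul0r; have [yt|yt] := leP (sqd 0 y) t; first by rewrite V0// mulr0.
  rewrite /G indicE memNset ?mulr0 ?mul0r//=; apply/negP; by rewrite -ltNge.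
have [mG LLG _] := LG.
have G2 : (\int[leb3]_x `|(G x ^+ 2)%:E| = 0)%E.
  have [iVGi _] := has_int3_mul _ _ LV LG.
  under eq_integral do rewrite gee0_abs ?lee_fin ?sqr_ge0// -GV.
  rewrite -[LHS]fineK; last exact: (integrable_fin_num measurableT iVGi).
  by move: iVG; rewrite /Rintegral => ->.
have mG2 : measurable_fun [set: mR3 R] (fun x => (G x ^+ 2)%:E).
  by apply/measurable_EFinP; exact: measurable_funX.
have := (ae_eq_integral_abs leb3 measurableT mG2).1 G2.
apply: filterS => x /(_ I) /= [] /eqP; rewrite sqrf_eq0 => /eqP Gx xt.
by move: Gx; rewrite /G indicE mem_set// mulr1.
Qed.

End WeakDerivatives.

(** * Tangent fields of constant length *)

Section TangentField.
Context {R : realType}.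
Local Notation has_int3 := (has_int (@leb3 R)).
Local Notation Int f := (\int[@leb3 R]_x f x).
Variable s : R.
Hypothesis s01 : 0 < s <= 1.
Variable W : 'I_3 -> R3 R -> R.
Variable g : 'I_3 -> 'I_3 -> R3 R -> R.
Hypothesis Wg : forall i j, weak_deriv s i (W j) (g i j).

(** At x, the field W is orthogonal to x and has squared length 3. *)
Definition tangent_at (x : R3 R) : Prop :=
  \sum_(j < 3) W j x ^+ 2 = 3 /\ \sum_(j < 3) coord3 j x * W j x = 0.

Hypothesis W_ae : {ae leb3, forall x : mR3 R, sqd 0 x <= s -> tangent_at x}.
(* W is modified on a null set so that the constraints hold wherever it is not 0. *)
Hypothesis W_or : forall x, tangent_at x \/ forall j, W j x = 0.

Let s0 : 0 < s. Proof. by case/andP: s01. Qed.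
Let s1 : s <= 1. Proof. by case/andP: s01. Qed.
Local Notation kern := (kern (delta s)).
Local Notation dkern := (dkern (delta s)).

Lemma LW j : L2B s (W j). Proof. by case: (Wg i0 j). Qed.
Lemma Lg i j : L2B s (g i j). Proof. by case: (Wg i j). Qed.

Lemma W_bounded j x : `|W j x| <= 2.
Proof.
have [[h _]|->] := W_or x; last by rewrite normr0.
have : W j x ^+ 2 <= 4.
  have : W j x ^+ 2 <= \sum_(k < 3) W k x ^+ 2.
    by rewrite (bigD1 j)//= lerDl sumr_ge0// => k _; rewrite sqr_ge0.
  by rewrite h; lra.
by move=> ?; rewrite ler_norml; apply/andP; split; nra.
Qed.

Lemma W_orth x : \sum_(j < 3) coord3 j x * W j x = 0.
Proof.
have [[_ ->]//|h] := W_or x.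
by rewrite big1// => j _; rewrite h mulr0.
Qed.

Lemma L2B_sum (F : 'I_3 -> R3 R -> R) : (forall j, L2B s (F j)) ->
  L2B s (fun x => \sum_(j < 3) F j x).
Proof.
move=> LF; rewrite (_ : (fun x => _) = fun x => F i0 x + F i1 x + F i2 x).
  by apply: L2B_add => //; exact: L2B_add.
by apply/funext => x; rewrite !big_ord_recr big_ord0 /= add0r;
  congr (F _ x + F _ x + F _ x); exact/val_inj.
Qed.

Lemma kern_vanish (t : R) n y : s / 4 <= t -> sqd 0 y <= t / 4 ->
  vanish_off t (fun x => kern n (x, y)).
Proof.
move=> st yt x xt; rewrite kern_eq0//.
by apply: (kern_far s s01 t) => //; rewrite /delta; lra.
Qed.

Lemma deriv_orth i : {ae leb3, forall x : mR3 R, sqd 0 x <= s / 4 ->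
  \sum_(j < 3) g i j x * coord3 j x + W i x = 0}.
Proof.
apply: (fundamental_lemma s s01 (s / 4)); first by have := s0; lra.
  apply: L2B_add; last exact: LW.
  apply: L2B_sum => j; apply: L2B_tfun; [exact: Lg|exact: tfun_coord].
move=> n y ys.
have tk := tfun_kern (delta s) n y.
have td := tfun_dkern (delta s) n i y.
have tc j := @tfun_coord R j.
have v j : vanish_off s (fun x => coord3 j x * kern n (x, y)).
  by move=> x xs; rewrite (kern_vanish s)// ?mulr0//; have := s0; lra.
have E j : has_int3 (fun x => g i j x * coord3 j x * kern n (x, y) +
    (i == j)%:R * W j x * kern n (x, y) +
    coord3 j x * W j x * dkern n i (x, y)) 0.
  have [_ _ H] := Wg i j; have {H} := H _ (tfun_mul _ _ (tc j) tk) (v j).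
  rewrite (partial3_mul i _ _ (tc j) tk) partial3_coord partial3_kern => E.
  have t1 : tfun (fun x => (i == j)%:R * kern n (x, y) + coord3 j x * dkern n i (x, y)).
    apply: tfun_add; apply: tfun_mul => //; exact: tfun_cst.
  have H1 := has_int3_tfun s s01 _ _ (LW j) t1.
  have H2 := has_int3_tfun s s01 _ _ (Lg i j) (tfun_mul _ _ (tc j) tk).
  rewrite E in H1; have := has_int_add _ _ _ _ _ H1 H2; rewrite addNr.
  by apply: eq_has_int => x; ring.
have H := has_int_sum leb3 _ (index_enum 'I_3) _ (fun=> 0) E.
rewrite big1 // in H.
suff [] : has_int3 (fun x => (\sum_(j < 3) g i j x * coord3 j x + W i x) * kern n (x, y)) 0.
  by [].
apply: eq_has_int H => x; rewrite !big_split/= -mulr_suml -[X in _ + _ + X]mulr_suml.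
rewrite W_orth mul0r addr0 mulrDl; congr (_ + _).
rewrite -mulr_suml (bigD1 i)//= eqxx mul1r big1 ?addr0// => j ji.
by rewrite eq_sym (negbTE ji) mul0r.
Qed.

Lemma deriv_norm i : {ae leb3, forall x : mR3 R, sqd 0 x <= s / 16 ->
  \sum_(j < 3) g i j x * W j x = 0}.
Proof.
apply: (fundamental_lemma s s01 (s / 16)); first by have := s0; lra.
  apply: L2B_sum => j; apply: (L2B_bounded _ _ _ 2); first exact: Lg.
    by case: (LW j).
  by move=> x _; exact: W_bounded.
move=> n y ys.
have tk := tfun_kern (delta s) n y.
have td := tfun_dkern (delta s) n i y.
have v : vanish_off (s / 4) (fun x => kern n (x, y)).
  by apply: kern_vanish; have := s0; lra.
have E j : has_int3 (fun x => W j x ^+ 2 * dkern n i (x, y) +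
    2 * (g i j x * W j x * kern n (x, y))) 0.
  have := weak_deriv_leibniz s s01 i _ _ _ _ _ (Wg i j) (Wg i j) tk v.
  rewrite partial3_kern => E.
  have H1 := has_int3_mul s _ _ (L2B_tfun _ _ _ (LW j) td) (LW j).
  have H2 := has_int3_mul s _ _ (L2B_tfun _ _ _ (LW j) tk) (Lg i j).
  have H3 := has_int3_mul s _ _ (L2B_tfun _ _ _ (Lg i j) tk) (LW j).
  have := has_int_add _ _ _ _ _ (has_int_add _ _ _ _ _ H1 H2) H3.
  by rewrite E; apply: eq_has_int => x; ring.
have H := has_int_sum leb3 _ (index_enum 'I_3) _ (fun=> 0) E.
rewrite big1 // in H.
have D : has_int3 (fun x => \sum_(j < 3) W j x ^+ 2 * dkern n i (x, y)) 0.
  have ys4 : sqd 0 y <= s / 4 by have := s0; lra.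
  have := has_int_scale _ 3 _ _ (int_dkern0 s s01 n i y ys4); rewrite mulr0.
  apply: ae_has_int.
    apply: measurable_sum => j; apply: measurable_funM.
      by apply: measurable_funX; case: (LW j).
    exact: tfun_measurable.
  apply: filterS W_ae => x hx; rewrite -mulr_suml.
  have [xs|xs] := leP (sqd 0 x) s; first by have [-> _] := hx xs.
  rewrite dkern_eq0 ?mulr0//; apply: (kern_far s s01 s) => //; last exact: ltW.
  by rewrite /delta; have := s0; lra.
suff [] : has_int3 (fun x => (\sum_(j < 3) g i j x * W j x) * kern n (x, y)) 0 by [].
have := has_int_scale _ (1 / 2) _ _ (has_int_sub _ _ _ _ _ H D).
rewrite subrr mulr0; apply: eq_has_int => x.
rewrite big_split/= addrAC subrr add0r -mulr_sumr mulrA mulr_suml.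
by rewrite div1r mulVf ?mul1r.
Qed.

(** A radial bump supported in the ball on which the differentiated constraints
    are available. *)
Definition cutoff x : R := flat 0 (s / 16 - sqd 0 x).

(** The test functions to which weak_deriv_curl is applied. *)
Definition quad_cutoff (a k : 'I_3) x : R := coord3 a x * coord3 k x * cutoff x.

Lemma tfun_cutoff : tfun cutoff. Proof. exact: tfun_bump. Qed.

Lemma tfun_quad_cutoff a k : tfun (quad_cutoff a k).
Proof.
apply: tfun_mul; last exact: tfun_cutoff.
by apply: tfun_mul; exact: tfun_coord.
Qed.

Lemma cutoff_off x : s / 16 <= sqd 0 x -> cutoff x = 0.
Proof. exact: bump_eq0. Qed.

Lemma partial3_quad_cutoff c a k : partial3 c (quad_cutoff a k) = fun x =>
  ((c == a)%:R * coord3 k x + coord3 a x * (c == k)%:R) * cutoff x +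
  coord3 a x * coord3 k x * ((- 2 * coord3 c x) * flat 2 (s / 16 - sqd 0 x)).
Proof.
have ta := @tfun_coord R a; have tk := @tfun_coord R k.
have tq : tfun (fun x : R3 R => s / 16 - sqd 0 x).
  by apply: tfun_sub; [exact: tfun_cst|exact: tfun_sqd].
have tm : tfun (fun x : R3 R => -1 * sqd 0 x).
  by apply: tfun_mul; [exact: tfun_cst|exact: tfun_sqd].
rewrite (partial3_mul c _ _ (tfun_mul _ _ ta tk) tfun_cutoff).
rewrite (partial3_mul c _ _ ta tk) !partial3_coord (partial3_flat c 0 _ tq).
rewrite (_ : (fun x : R3 R => s / 16 - sqd 0 x) = fun x => s / 16 + -1 * sqd 0 x); last first.
  by apply/funext => x; rewrite mulN1r.
rewrite (partial3_add c _ _ (tfun_cst _) tm) partial3_cst.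
rewrite (partial3_mul c _ _ (tfun_cst (-1)) (tfun_sqd 0)) partial3_cst partial3_sqd.
apply/funext => x; rewrite coord3_0 mulN1r /cutoff; ring.
Qed.

(** The integrand of weak_deriv_curl for the components j and l of W, in the
    directions b and c. *)
Definition curlterm (a b c j k l : 'I_3) x : R :=
  (W l x * partial3 c (quad_cutoff a k) x) * g b j x -
  (W l x * partial3 b (quad_cutoff a k) x) * g c j x +
  ((g c l x * quad_cutoff a k x) * g b j x - (g b l x * quad_cutoff a k x) * g c j x).

Lemma int_curlterm a b c j k l : has_int3 (curlterm a b c j k l) 0.
Proof.
have t := tfun_quad_cutoff a k.
have v : vanish_off (s / 4) (quad_cutoff a k).
  by move=> x xs; rewrite /quad_cutoff cutoff_off ?mulr0//; have := s0; lra.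
have Ld i := L2B_tfun s _ _ (LW l) (tfun_partial i _ t).
have Lp i := L2B_tfun s _ _ (Lg i l) t.
rewrite -(weak_deriv_curl s s01 b c _ _ _ _ _ _ _ (Wg b j) (Wg c j) (Wg b l) (Wg c l) t v).
by apply: has_int_add; apply: has_int_sub; apply: has_int3_mul => //; exact: Lg.
Qed.

(** The sum of the terms curlterm over the six permutations (j, k, l) of the
    indices, with their signs. *)
Definition alternating (a b c : 'I_3) x : R :=
  (curlterm a b c i0 i1 i2 x - curlterm a b c i0 i2 i1 x) +
  (curlterm a b c i1 i2 i0 x - curlterm a b c i1 i0 i2 x) +
  (curlterm a b c i2 i0 i1 x - curlterm a b c i2 i1 i0 x).

Lemma int_alternating a b c : has_int3 (alternating a b c) 0.
Proof.
have H0 (u v : R3 R -> R) : has_int3 u 0 -> has_int3 v 0 -> has_int3 (fun x => u x - v x) 0.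
  by move=> hu hv; rewrite -(subrr 0); exact: has_int_sub.
rewrite -[X in has_int3 _ X](addr0 0); apply: has_int_add; last first.
  by apply: H0; exact: int_curlterm.
rewrite -[X in has_int3 _ X](addr0 0); apply: has_int_add.
  by apply: H0; exact: int_curlterm.
by apply: H0; exact: int_curlterm.
Qed.

(** Write g_b for the derivative of W in direction b.  The cyclic sum is cutoff x
    times the sum of three quantities: the products -2 x_a det (x, g_b, g_c); the
    divergence of W times x . W; and the sum of the - W_b (x . g_b).
    The determinants vanish because x and the g_b are all orthogonal to W, and
    the last sum is the squared length of W because x . g_b = - W_b. *)
Lemma alternating_sum x : sqd 0 x <= s / 16 -> tangent_at x ->
  (forall i, \sum_(j < 3) g i j x * coord3 j x + W i x = 0) ->
  (forall i, \sum_(j < 3) g i j x * W j x = 0) ->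
  alternating i0 i1 i2 x + alternating i1 i2 i0 x + alternating i2 i0 i1 x =
  3 * cutoff x.
Proof.
have sum3 (F : 'I_3 -> R) : \sum_(j < 3) F j = F i0 + F i1 + F i2.
  by rewrite !big_ord_recr big_ord0 /= add0r;
    congr (F _ + F _ + F _); exact/val_inj.
move=> _ [nW xW] oW nG.
have := oW i2; have := oW i1; have := oW i0.
have := nG i2; have := nG i1; have := nG i0.
have e01 : (i0 == i1) = false by []. have e02 : (i0 == i2) = false by [].
have e10 : (i1 == i0) = false by []. have e12 : (i1 == i2) = false by [].
have e20 : (i2 == i0) = false by []. have e21 : (i2 == i1) = false by [].
move: xW nW; rewrite !sum3 /alternating /curlterm !partial3_quad_cutoff /quad_cutoff.
rewrite !eqxx e01 e02 e10 e12 e20 e21 [true%:R](_ : _ = 1)// [false%:R](_ : _ = 0)//.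
move: (coord3 i0 x) (coord3 i1 x) (coord3 i2 x) => x0 x1 x2.
move: (W i0 x) (W i1 x) (W i2 x) => w0 w1 w2.
move: (g i0 i0 x) (g i0 i1 x) (g i0 i2 x) => p0 p1 p2.
move: (g i1 i0 x) (g i1 i1 x) (g i1 i2 x) => q0 q1 q2.
move: (g i2 i0 x) (g i2 i1 x) (g i2 i2 x) => r0 r1 r2.
move: (cutoff x) (flat 2 _) => h h' xW nW wp wq wr xp xq xr.
(* Three vectors orthogonal to W are linearly dependent. *)
have det0 a0 a1 a2 b0 b1 b2 : a0 * w0 + a1 * w1 + a2 * w2 = 0 ->
    b0 * w0 + b1 * w1 + b2 * w2 = 0 ->
    x0 * (a1 * b2 - a2 * b1) + x1 * (a2 * b0 - a0 * b2) + x2 * (a0 * b1 - a1 * b0) = 0.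
  move=> aw bw; apply: (mulfI (_ : 3 != 0 :> R)); first by [].
  rewrite mulr0 -nW.
  transitivity ((x0 * w0 + x1 * w1 + x2 * w2) * (w0 * (a1 * b2 - a2 * b1) +
      w1 * (a2 * b0 - a0 * b2) + w2 * (a0 * b1 - a1 * b0)) +
    (a0 * w0 + a1 * w1 + a2 * w2) * (w0 * (b1 * x2 - b2 * x1) +
      w1 * (b2 * x0 - b0 * x2) + w2 * (b0 * x1 - b1 * x0)) +
    (b0 * w0 + b1 * w1 + b2 * w2) * (w0 * (x1 * a2 - x2 * a1) +
      w1 * (x2 * a0 - x0 * a2) + w2 * (x0 * a1 - x1 * a0))); first by ring.
  by rewrite xW aw bw !mul0r !addr0.
have D0 := det0 _ _ _ _ _ _ wq wr.
have D1 := det0 _ _ _ _ _ _ wr wp.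
have D2 := det0 _ _ _ _ _ _ wp wq.
transitivity (h * (- 2 * (
    x0 * (x0 * (q1 * r2 - q2 * r1) + x1 * (q2 * r0 - q0 * r2) + x2 * (q0 * r1 - q1 * r0)) +
    x1 * (x0 * (r1 * p2 - r2 * p1) + x1 * (r2 * p0 - r0 * p2) + x2 * (r0 * p1 - r1 * p0)) +
    x2 * (x0 * (p1 * q2 - p2 * q1) + x1 * (p2 * q0 - p0 * q2) + x2 * (p0 * q1 - p1 * q0))) +
  (p0 + q1 + r2) * (x0 * w0 + x1 * w1 + x2 * w2) -
  (w0 * (p0 * x0 + p1 * x1 + p2 * x2 + w0) + w1 * (q0 * x0 + q1 * x1 + q2 * x2 + w1) +
   w2 * (r0 * x0 + r1 * x1 + r2 * x2 + w2)) + (w0 ^+ 2 + w1 ^+ 2 + w2 ^+ 2))).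
  by ring.
by rewrite D0 D1 D2 xW xp xq xr nW; ring.
Qed.

(** The cyclic sum has integral 0 by weak_deriv_curl, while it equals three times
    a bump of positive integral. *)
Lemma no_tangent_field : False.
Proof.
have HH : has_int3 (fun x => 3 * cutoff x) 0.
  have h0 := has_int_add _ _ _ _ _
    (has_int_add _ _ _ _ _ (int_alternating i0 i1 i2) (int_alternating i1 i2 i0))
    (int_alternating i2 i0 i1).
  rewrite !addr0 in h0; apply: ae_has_int h0.
    by apply: measurable_funM => //; exact: tfun_measurable tfun_cutoff.
  have oW := deriv_orth; have nG := deriv_norm.
  have FF := ae_filter_ringOfSetsType (@leb3 R).
  have ae3 (P : 'I_3 -> R3 R -> Prop) : (forall i, {ae leb3, forall x : mR3 R, P i x}) ->
      {ae leb3, forall x : mR3 R, forall i, P i x}.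
    move=> aP; apply: (@filterS3 _ _ FF _ _ _ _ _ (aP i0) (aP i1) (aP i2)).
    by move=> x ? ? ?; elim/ord3_ind.
  apply: (@filterS3 _ _ FF _ _ _ _ _ (ae3 _ oW) (ae3 _ nG) W_ae).
  move=> x hx1 hx2 hx3.
  have [xs|xs] := leP (sqd 0 x) (s / 16).
    apply: alternating_sum => //.
    - by apply: hx3; have := s0; lra.
    - by move=> i; apply: hx1; have := s0; lra.
    - by move=> i; exact: hx2.
  have pz a k : quad_cutoff a k x = 0 by rewrite /quad_cutoff cutoff_off ?mulr0// ltW.
  have dz c a k : partial3 c (quad_cutoff a k) x = 0.
    apply: (vanish_off_partial (s / 16)) xs; first exact: tfun_quad_cutoff.
    by move=> z zs; rewrite /quad_cutoff cutoff_off ?mulr0.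
  by rewrite cutoff_off ?ltW// mulr0 /alternating /curlterm !pz !dz; ring.
have t01 : 0 < s / 16 <= 1 by apply/andP; split; have := s0; have := s1; lra.
have := has_int_scale _ (3^-1) _ _ HH; rewrite mulr0 => -[i e].
have hE : (fun x => 3^-1 * (3 * cutoff x)) = cutoff by apply/funext => x; rewrite mulKf.
rewrite hE in i e.
have := bump_mass_gt0 _ t01; rewrite -[bump_mass (s / 16)]fineK.
  by rewrite [fine _]e ltxx.
exact: (integrable_fin_num measurableT i).
Qed.

End TangentField.

(** * Open sets and test functions *)

Section OpenSets.
Context {R : realType}.
Local Notation Ball s := [set x : R3 R | sqd 0 x <= s].
Implicit Types (x y : R3 R) (Omega : set (R3 R)).

(** The open cube of half-side r around a. *)
Definition box (r : R) (a : R3 R) : set (mR3 R) := [set x | forall i, `|coord3 i x - coord3 i a| < r].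

Lemma measurable_box r a : measurable (box r a).
Proof.
have m i : measurable [set x : mR3 R | `|coord3 i x - coord3 i a| < r].
  rewrite (_ : mkset _ = setT `&` (fun x : mR3 R => `|coord3 i x - coord3 i a|) @^-1` `]-oo, r[%classic).
    suff : measurable_fun [set: mR3 R] (fun x : mR3 R => `|coord3 i x - coord3 i a|) by exact.
    apply: measurableT_comp => //; apply: measurable_funB => //.
    exact: measurable_coord3.
  by rewrite setTI; apply/seteqP; split => x /=; rewrite in_itv.
rewrite (_ : box r a = [set x : mR3 R | `|coord3 i0 x - coord3 i0 a| < r] `&`
  [set x : mR3 R | `|coord3 i1 x - coord3 i1 a| < r] `&`
  [set x : mR3 R | `|coord3 i2 x - coord3 i2 a| < r]).
  by apply: measurableI => //; exact: measurableI.
apply/seteqP; split => x /=; first by move=> h; do !split; exact: h.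
by move=> [[h0 h1] h2]; elim/ord3_ind.
Qed.

Lemma open_box Omega x : open Omega -> Omega x ->
  exists2 r : R, 0 < r & box r x `<=` Omega.
Proof.
rewrite openE => oO Ox; have /nbhs_ballP[r /= r0 hr] := oO x Ox.
exists r => // y hy; apply: hr.
split; first split.
- by rewrite /ball/= distrC; exact: (hy i0).
- by rewrite /ball/= distrC; exact: (hy i1).
- by rewrite /ball/= distrC; exact: (hy i2).
Qed.

(** The Borel sigma-algebra of the product topology is contained in the product
    sigma-algebra: an open set is a countable union of rational cubes. *)
Lemma open_measurable3 Omega : open Omega -> measurable (Omega : set (mR3 R)).
Proof.
move=> oO.
pose c (p q t : rat) : R3 R := (ratr p, ratr q, ratr t).
pose B p q t n : set (mR3 R) :=
  if `[< box n.+1%:R^-1 (c p q t) `<=` Omega >] then box n.+1%:R^-1 (c p q t) else set0.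
have -> : Omega = \bigcup_p \bigcup_q \bigcup_t \bigcup_n B p q t n.
  apply/seteqP; split => x; last first.
    by move=> [p _ [q _ [t _ [n _]]]]; rewrite /B; case: asboolP => // h /h.
  move=> Ox; have [r r0 hr] := open_box Omega x oO Ox.
  have [n _ hn] : exists2 n, True & n.+1%:R^-1 + n.+1%:R^-1 < r.
    pose m := Num.truncn (2 / r); exists m => //.
    have : 2 / r < m.+1%:R by exact: truncnS_gt.
    rewrite ltr_pdivrMr // => h; have m0 : (0 : R) < m.+1%:R by [].
    rewrite (_ : _ + _ = 2 / m.+1%:R); last by field; rewrite gt_eqF.
    by rewrite ltr_pdivrMr // mulrC.
  have d (z : R) : exists p : rat, `|z - ratr p| < n.+1%:R^-1.
    have : (0 : R) < n.+1%:R^-1 by rewrite invr_gt0.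
    move: (n.+1%:R^-1) => e e0; have zz : z < z + e by rewrite ltrDl.
    have [p] := rat_in_itvoo zz; rewrite in_itv/= => /andP[h1 h2].
    by exists p; rewrite ltr_norml; apply/andP; split; lra.
  have [p hp] := d x.1.1; have [q hq] := d x.1.2; have [t ht] := d x.2.
  exists p => //; exists q => //; exists t => //; exists n => //.
  have cx i : `|coord3 i x - coord3 i (c p q t)| < n.+1%:R^-1 by elim/ord3_ind: i.
  rewrite /B asboolT//= => y hy; apply: hr => i.
  have := cx i; have := hy i; move: hn; move: (n.+1%:R^-1) => e he.
  by rewrite !ltr_norml => /andP[? ?] /andP[? ?]; apply/andP; split; lra.
do 3 (apply: bigcupT_measurable_rat => ?).
apply: bigcupT_measurable => n.
by rewrite /B; case: asboolP => _ //; exact: measurable_box.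
Qed.

Lemma Ball_in_open Omega : open Omega -> Omega 0 ->
  exists2 s : R, 0 < s <= 1 & Ball s `<=` Omega.
Proof.
move=> oO O0; have [r r0 hr] := open_box Omega 0 oO O0.
exists (Num.min 1 (r ^+ 2 / 2)).
  by rewrite lt_min ltr01 divr_gt0 ?exprn_gt0//= ge_min lexx.
move=> x /= xs; apply: hr => i; rewrite coord3_0 subr0.
have : sqd 0 x <= r ^+ 2 / 2 by apply: le_trans xs _; rewrite ge_min lexx orbT.
have := coord3_sqd i 0 x; rewrite coord3_0 sub0r sqrrN => h1 h2.
have h3 : coord3 i x ^+ 2 < r ^+ 2 by have := exprn_gt0 2 r0; lra.
by rewrite ltr_norml; apply/andP; split; nra.
Qed.

Lemma sqd_continuous (a : R3 R) : continuous (sqd a).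
Proof. by move=> x; exact/differentiable_continuous/tfun_diff/tfun_sqd. Qed.

Lemma Ball_closed s : closed (Ball s).
Proof.
rewrite (_ : Ball s = sqd 0 @^-1` [set t | t <= s])//.
by apply: closed_comp; [move=> x _; exact: sqd_continuous|exact: closed_le].
Qed.

Lemma Ball_compact s : s <= 1 -> compact (Ball s).
Proof.
move=> s1; have c := @segment_compact R (-1) 1.
apply: (subclosed_compact (Ball_closed s) (compact_setX (compact_setX c c) c)).
move=> x /= xs; have h i : coord3 i x \in `[-1, 1].
  have := coord3_sqd i 0 x; rewrite coord3_0 sub0r sqrrN => h.
  have {}h : coord3 i x ^+ 2 <= 1 by lra.
  by rewrite in_itv/=; apply/andP; split; nra.
by split; [split; [exact: (h i0)|exact: (h i1)]|exact: (h i2)].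
Qed.

Lemma tfun_test_function Omega s psi : s <= 1 -> Ball s `<=` Omega ->
  tfun psi -> vanish_off s psi -> test_function Omega psi.
Proof.
move=> s1 BO tpsi v.
have sub : tsupport psi `<=` Ball s.
  rewrite /tsupport [X in _ `<=` X]((closure_id _).1 (Ball_closed s)).
  apply: closure_subset => x /= /eqP px.
  by rewrite leNgt; apply/negP => xs; apply: px; rewrite v// ltW.
split; first exact: tfun_smooth.
- exact: (subclosed_compact (@closed_closure _ _) (Ball_compact s s1) sub).
- exact: subset_trans sub BO.
Qed.

End OpenSets.

(** * Restriction to a ball *)

Section Restriction.
Context {R : realType}.
Variables (Omega : set (R3 R)) (s : R) (N : set (mR3 R)).
Hypothesis oO : open Omega.
Hypothesis s01 : 0 < s <= 1.
Hypothesis BO : [set x : R3 R | sqd 0 x <= s] `<=` Omega.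
Hypothesis mN : measurable N.
Hypothesis N0 : leb3 N = 0%E.
Implicit Types (f g : R3 R -> R).

(** A ball inside Omega, deprived of the null set N on which pointwise
    constraints may fail.  Once a field is replaced by 0 outside this set, at every
    point either it satisfies the constraints or it vanishes; its weak derivatives
    inside the ball are not affected. *)
Definition mask : set (mR3 R) := [set x | sqd 0 x <= s] `\` N.

Let mO : measurable (Omega : set (mR3 R)). Proof. exact: open_measurable3. Qed.

Lemma measurable_mask : measurable mask.
Proof. by apply: measurableD => //; exact: measurable_Ball. Qed.

Lemma mask_sub : mask `<=` Omega. Proof. by move=> x [/BO]. Qed.

Lemma L2_mask f : L2 Omega f -> L2B s (f \_ mask).
Proof.
move=> [mf Lf].
have mm : measurable_fun [set: mR3 R] (f \_ mask).
  apply/(measurable_restrictT _ measurable_mask).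
  exact: (measurable_funS mO mask_sub mf).
split=> //.
- apply: le_lt_trans Lf; rewrite integral_mkcond.
  apply: ge0_le_integral => //.
  + by move=> x _; rewrite lee_fin sqr_ge0.
  + by apply/measurable_EFinP; exact: measurable_funX.
  + apply/(measurable_restrictT _ mO); apply/measurable_EFinP.
    exact: measurable_funX.
  + move=> x _; rewrite /patch; case: ifPn => [/set_mem /mask_sub xO|_].
      by rewrite mem_set.
    by rewrite expr0n; case: ifPn => _; rewrite lee_fin// sqr_ge0.
- move=> x xs; rewrite /patch memNset// => -[/= h _].
  by move: xs; rewrite ltNge h.
Qed.

Lemma int_mask f psi : L2 Omega f -> tfun psi ->
  (forall x, s < sqd 0 x -> psi x = 0) ->
  (\int[lebesgue3]_(x in Omega) (f x * psi x)%:E =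
   \int[leb3]_x ((f \_ mask) x * psi x)%:E)%E.
Proof.
move=> Lf tpsi v; have [mm _ _] := L2_mask f Lf; case: Lf => mf _.
have mpsi := tfun_measurable _ tpsi.
rewrite integral_mkcond; apply: ae_eq_integral => //.
- apply/(measurable_restrictT _ mO); apply/measurable_EFinP.
  by apply: measurable_funM => //; exact: measurable_funTS.
- by apply/measurable_EFinP; exact: measurable_funM.
exists N; split=> // x /= hx; apply: contrapT => Nx; apply: hx => _.
rewrite /patch; have [xs|xs] := leP (sqd 0 x) s; last first.
  by rewrite v// !mulr0; case: ifP.
by rewrite mem_set; [rewrite mem_set|exact: BO].
Qed.

Lemma weak_partial_mask i f g : L2 Omega f -> L2 Omega g ->
  weak_partial Omega i f g -> weak_deriv s i (f \_ mask) (g \_ mask).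
Proof.
move=> Lf Lg fg; split; [exact: L2_mask|exact: L2_mask|] => psi tpsi v.
have s1 : s <= 1 by case/andP: s01.
have := fg psi (tfun_test_function Omega s psi s1 BO tpsi v).
rewrite int_mask//; last 2 first.
- exact: tfun_partial.
- by move=> x xs; exact: (vanish_off_partial s).
rewrite int_mask//; last by move=> x xs; rewrite v// ltW.
by rewrite /Rintegral => ->; rewrite fineN.
Qed.

End Restriction.

(** * The difference of two unit fields *)

Section Main.
Context {R : realType}.

Lemma weak_deriv_sub (s : R) i (f g f' g' : R3 R -> R) : 0 < s <= 1 ->
  weak_deriv s i f f' -> weak_deriv s i g g' -> weak_deriv s i (fun x => f x - g x) (fun x => f' x - g' x).
Proof.
move=> s01 [Lf Lf' wf] [Lg Lg' wg].
have sub h k : L2B s h -> L2B s k -> L2B s (fun x => h x - k x).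
  move=> Lh Lk; rewrite (_ : (fun x => _) = fun x => h x + -1 * k x).
    by apply: L2B_add => //; exact: L2B_scale.
  by apply/funext => x; rewrite mulN1r.
split; [exact: sub|exact: sub|] => psi tpsi v.
have td := tfun_partial i _ tpsi.
have H1 := has_int_sub _ _ _ _ _ (has_int3_tfun s s01 _ _ Lf td) (has_int3_tfun s s01 _ _ Lg td).
have H2 := has_int_sub _ _ _ _ _ (has_int3_tfun s s01 _ _ Lf' tpsi) (has_int3_tfun s s01 _ _ Lg' tpsi).
under eq_Rintegral do rewrite mulrBl.
under [X in _ = - X]eq_Rintegral do rewrite mulrBl.
have [_ ->] := H1; have [_ ->] := H2.
by rewrite wf// wg// opprB opprK addrC.
Qed.

(** The parallelogram law: two unit vectors whose sum is a unit vector differ by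
    a vector of squared length 3, orthogonal to the sum. *)
Lemma sphere_algebra (a b x : R3 R) : x != 0 -> enorm a = 1 -> enorm b = 1 ->
  a + b = (enorm x)^-1 *: x ->
  \sum_(j < 3) (coord3 j a - coord3 j b) ^+ 2 = 3 /\
  \sum_(j < 3) coord3 j x * (coord3 j a - coord3 j b) = 0.
Proof.
have sum3 (F : 'I_3 -> R) : \sum_(j < 3) F j = F i0 + F i1 + F i2.
  by rewrite !big_ord_recr big_ord0 /= add0r;
    congr (F _ + F _ + F _); exact/val_inj.
move=> x0 a1 b1 abx.
have sq (u : R3 R) : enorm u ^+ 2 = coord3 i0 u ^+ 2 + coord3 i1 u ^+ 2 + coord3 i2 u ^+ 2.
  by rewrite sqr_sqrtr ?sum3// addr_ge0 ?addr_ge0 ?sqr_ge0.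
have r0 : enorm x != 0.
  apply: contraNneq x0 => e; move: (sq x); rewrite e expr0n/= => /esym/eqP.
  rewrite !paddr_eq0 ?addr_ge0 ?sqr_ge0// !sqrf_eq0 => /andP[/andP[/eqP h0 /eqP h1] /eqP h2].
  case: x h0 h1 h2 {e abx} => [[p q] t]; rewrite coord30 coord31 coord32 /=.
  by move=> -> -> ->.
have c i : coord3 i x = enorm x * (coord3 i a + coord3 i b).
  have -> : coord3 i a + coord3 i b = (enorm x)^-1 * coord3 i x.
    by have := congr1 (coord3 i) abx; elim/ord3_ind: i.
  by rewrite mulVKf.
have := sq a; have := sq b; have := sq x; rewrite a1 b1 !expr1n !sum3 !c.
move: r0; move: (enorm x) => r r0.
move: (coord3 i0 a) (coord3 i1 a) (coord3 i2 a) => a0 a_1 a2.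
move: (coord3 i0 b) (coord3 i1 b) (coord3 i2 b) => b0 b_1 b2.
move=> hx hb ha.
have h1 : (a0 + b0) ^+ 2 + (a_1 + b_1) ^+ 2 + (a2 + b2) ^+ 2 = 1.
  apply: (mulfI (_ : r ^+ 2 != 0)); first by rewrite sqrf_eq0.
  by rewrite mulr1 [RHS]hx; ring.
split.
  transitivity (2 * (a0 ^+ 2 + a_1 ^+ 2 + a2 ^+ 2) + 2 * (b0 ^+ 2 + b_1 ^+ 2 + b2 ^+ 2) -
    ((a0 + b0) ^+ 2 + (a_1 + b_1) ^+ 2 + (a2 + b2) ^+ 2)); first by ring.
  by rewrite -ha -hb h1; ring.
transitivity (r * ((a0 ^+ 2 + a_1 ^+ 2 + a2 ^+ 2) - (b0 ^+ 2 + b_1 ^+ 2 + b2 ^+ 2))).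
  by ring.
by rewrite -ha -hb subrr mulr0.
Qed.

End Main.

Theorem proposition3p1 (R : realType) (Omega : set (R * R * R))
    (openOmega : open Omega) (Omega0 : Omega 0) :
  ~ exists u1 u2 : R * R * R -> R * R * R,
      [/\ sobolev_H1_S2 Omega u1, sobolev_H1_S2 Omega u2 &
          {ae lebesgue3, forall x, Omega x ->
             u1 x + u2 x = (enorm x)^-1 *: x}].
Proof.
move=> [u1 [u2 [[H1 [N1 [mN1 N10 sN1]]] [H2 [N2 [mN2 N20 sN2]]] [N3 [mN3 N30 sN3]]]]].
have [s s01 BO] := Ball_in_open Omega openOmega Omega0.
(* A null plane through the origin, discarded because the hypothesis gives
   u1 0 + u2 0 = 0, the inverse of 0 being 0. *)
pose N4 : set (mR3 R) := [set x | coord3 i0 x = 0].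
have mN4 : measurable N4.
  rewrite (_ : N4 = setT `&` coord3 i0 @^-1` [set 0]); last by rewrite setTI.
  exact: (@measurable_coord3 R i0).
pose N := N1 `|` N2 `|` N3 `|` N4.
have mN : measurable N by do 3 (apply: measurableU => //).
have N0 : leb3 N = 0%E.
  apply: null_set_setU => //; last exact: leb3_coord_null.
    by do 2 (apply: measurableU => //).
  apply: null_set_setU => //; first exact: measurableU.
  exact: null_set_setU.
pose M := mask s N.
have good x : M x -> \sum_(j < 3) (coord3 j (u1 x) - coord3 j (u2 x)) ^+ 2 = 3 /\
  \sum_(j < 3) coord3 j x * (coord3 j (u1 x) - coord3 j (u2 x)) = 0.
  move=> [/= xs Nx]; have Ox := BO x xs.
  apply: sphere_algebra.
  - by apply/eqP => x0; apply: Nx; right; rewrite x0 /N4 /= coord3_0.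
  - by apply: contrapT => h; apply: Nx; left; left; left; apply: sN1 => /= /(_ Ox).
  - by apply: contrapT => h; apply: Nx; left; left; right; apply: sN2 => /= /(_ Ox).
  - by apply: contrapT => h; apply: Nx; left; right; apply: sN3 => /= /(_ Ox).
have W1 i j : exists g, weak_deriv s i ((coord3 j \o u1) \_ M) g.
  have [Lf /(_ i)[g Lg fg]] := H1 j.
  by exists (g \_ M); exact: (weak_partial_mask Omega).
have W2 i j : exists g, weak_deriv s i ((coord3 j \o u2) \_ M) g.
  have [Lf /(_ i)[g Lg fg]] := H2 j.
  by exists (g \_ M); exact: (weak_partial_mask Omega).
pose W j x := ((coord3 j \o u1) \_ M) x - ((coord3 j \o u2) \_ M) x.
have Wex i j : exists g, weak_deriv s i (W j) g.
  have [g1 h1] := W1 i j; have [g2 h2] := W2 i j.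
  by exists (fun x => g1 x - g2 x); exact: weak_deriv_sub.
pose g i j := projT1 (cid (Wex i j)).
have Wg i j : weak_deriv s i (W j) (g i j) by exact: (projT2 (cid (Wex i j))).
have tM x : M x -> tangent_at W x.
  move=> Mx; have [h1 h2] := good x Mx.
  rewrite /tangent_at /W; split.
    by rewrite -[RHS]h1; apply: eq_bigr => j _; rewrite /patch mem_set.
  by rewrite -[RHS]h2; apply: eq_bigr => j _; rewrite /patch mem_set.
apply: (no_tangent_field s s01 W g Wg).
- exists N; split=> // x /= hx; apply: contrapT => Nx; apply: hx => xs.
  exact: tM.
- move=> x; have [Mx|Mx] := pselect (M x); first by left; exact: tM.
  by right => j; rewrite /W /patch memNset// subr0.
Qed.
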